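(* Let $\kappa \leq \mu= \mu^{<\kappa}$ be cardinals, with $\kappa$ inaccessible. The following are equivalent: (1) $\kappa$-$\mathcal{L}_{\omega,\omega}$-compactness with type omission for languages of size $\mu$ holds. (2) $\mathrm{LSCP}(P_\kappa\mu, \kappa\text{-clubs})$ holds. (3) $\mathrm{LSCP}(P_\kappa\mu, \kappa\text{-cofinally})$ holds.
   Context: For a cardinal $\rho$ (not necessarily regular) and a set $X$, $P_\rho X$ is the set of all subsets of $X$ of size $<\rho$. A set $E\subseteq P_\rho X$ is a club if for every $x \in P_\rho X$ there is $y \in E$ with $x \subseteq y$, and $E$ is closed under unions of increasing sequences of length $<\operatorname{cf} \rho$. ''For club many $x$'' means for all $x$ in some club. Type omission. $\mathcal L_{\omega,\omega}$ is first order logic. A type $p=p(x)$ is a set of formulas in the free variable $x$; a model omits $p$ if no element of it satisfies all formulas of $p$. Elements of $P_\kappa(T\cup p)$ are written as $T'\cup p'$ with $T'\subseteq T$ and $p'\subseteq p$. $\kappa$-$\mathcal{L}_{\omega,\omega}$-compactness with type omission for languages of size $\mu$ holds if for every first order theory $T$ and first order type $p$ (over a language of size $\mu$) such that for club many $T' \cup p'\in P_\kappa (T \cup p)$ there is a model of $T'$ that omits $p'$, there is a model of $T$ that omits $p$. Trees. A $P_\kappa\mu$-tree is a function $\mathcal{T} = \langle \mathcal{T}_x \mid x \in P_\kappa \mu\rangle$ such that: for every $x\in P_\kappa \mu$, $\mathcal{T}_x \subseteq {}^x 2$ is non-empty; for $x \subseteq y \in P_\kappa \mu$ and $\eta \in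 \mathcal{T}_y$, $\eta \restriction x \in \mathcal{T}_x$; and $|\mathcal{T}_x| < \kappa$ for every $x\in P_\kappa \mu$. A (cofinal) branch through $\mathcal{T}$ is a function $b \colon \mu\to 2$ such that $b\restriction x \in \mathcal{T}_x$ for all $x\in P_\kappa\mu$. Ladder systems. A set $L$ is a ladder system on a $P_\kappa\mu$-tree $\mathcal T$ if: (1) $L \subseteq \bigcup_{x\in P_\kappa\mu} \mathcal T_x$; (2) for club many $x\in P_\kappa\mu$, $L \cap \mathcal T_x \neq \emptyset$; (3) if $\eta \in L \cap \mathcal T_x$ and $\operatorname{cf} (|x \cap \kappa|) > \omega$ then there is a club $E_\eta \subseteq P_{|x \cap \kappa|} x$ such that $\{\eta \restriction y \mid y \in E_\eta\} \subseteq L$. Let $\rho \leq \kappa$ be a regular cardinal. A cofinal branch $b$ meets $L$ $\rho$-cofinally if for every $x \in P_\rho\mu$ there is $z \supseteq x$ ($z\in P_\kappa\mu$) such that $b\restriction z \in L$. It meets $L$ $\rho$-club often if for club many $x \in P_\rho\mu$, $b\restriction x \in L$. $\mathrm{LSCP}(P_\kappa\mu, \rho\text{-clubs})$ (respectively $\mathrm{LSCP}(P_\kappa\mu,\rho\text{-cofinally})$), the ladder system catching property, says: for every $P_\kappa \mu$-tree $\mathcal T$ and every ladder system $L$ on $\mathcal T$ there is a cofinal branch of $\mathcal{T}$ that meets $L$ $\rho$-club often (respectively $\rho$-cofinally). *)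

(* Defs.v *)
From mathcomp Require Import all_boot all_order all_classical.
From mathcomp Require Import wochoice.
Set Implicit Arguments.
Unset Strict Implicit.
Unset Printing Implicit Defensive.
Import Order.TTheory.
Local Open Scope classical_set_scope.
Local Open Scope card_scope.

(* The cardinal mu is a well-ordered type.  An ordinal <= mu is a down-closed
   set of elements of mu, the element a of mu standing for the ordinal [seg a].
   In particular kappa <= mu is a subset of mu, and |x `&` kappa| makes sense
   for x a subset of mu. *)

Definition card_lt T U (A : set T) (B : set U) : bool :=
  (A #<= B) && ~~ (B #<= A).
Notation "A '#<' B" := (card_lt A B) (at level 79) : card_scope.

Section Cardinals.
Context {d : Order.disp_t} {mu : orderType d}.

Definition seg (a : mu) : set mu := [set b | (b < a)%O].

(* |A| as an initial ordinal, |A| = {a | |a| < |A|}; meaningful for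
   |A| <= |mu|. *)
Definition cardinal T (A : set T) : set mu := [set a | seg a #< A].

Definition is_cardinal (rho : set mu) : Prop := cardinal rho = rho.

Definition unbounded (rho C : set mu) : Prop :=
  C `<=` rho /\ forall a, rho a -> exists2 c, C c & (a <= c)%O.

(* The least cardinality of an unbounded subset of rho; the minimum of a
   nonempty set of ordinals is its intersection. *)
Definition cof (rho : set mu) : set mu :=
  \bigcap_(C in [set C | unbounded rho C]) cardinal C.

Definition regular (rho : set mu) : Prop :=
  [/\ is_cardinal rho, [set: nat] #<= rho & cof rho = rho].

Definition inaccessible (kappa : set mu) : Prop :=
  [/\ regular kappa, ~~ countable kappa &
      forall a, kappa a -> [set A | A `<=` seg a] #< kappa].

(* The sequences of elements of mu of length < kappa; mu ^ (< kappa) is their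
   number, the supremum of the mu ^ lambda for lambda < kappa <= mu. *)
Definition short_seqs (kappa : set mu) : Type :=
  {a : mu & kappa a & seg a -> mu}.

End Cardinals.

Section Clubs.
Context {d : Order.disp_t} {mu : orderType d}.

Definition Psub T (rho : set mu) (X : set T) : set (set T) :=
  [set x | x `<=` X /\ x #< rho].

(* Closure is under unions of nonempty increasing sequences: the empty union
   would force the empty set into every club.  The length l ranges over the
   ordinals below cof rho, which are the elements of [cof rho]. *)
Definition club T (rho : set mu) (X : set T) (E : set (set T)) : Prop :=
  [/\ E `<=` Psub rho X,
      forall x, Psub rho X x -> exists2 y, E y & x `<=` y &
      forall (l : mu) (s : mu -> set T),
        cof rho l -> seg l !=set0 ->
        (forall a, seg l a -> E (s a)) ->
        (forall a b, seg l b -> (a <= b)%O -> s a `<=` s b) ->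
        E (\bigcup_(a in seg l) s a)].

Definition club_many T (rho : set mu) (X : set T) (Q : set T -> Prop) : Prop :=
  exists2 E, club rho X E & forall x, E x -> Q x.

End Clubs.

Section Trees.
Context {d : Order.disp_t} {mu : orderType d}.

(* Functions from a subset x of mu to 2 are partial functions on mu with
   domain x. *)
Definition pfun2 : Type := mu -> option bool.

Definition dom (eta : pfun2) : set mu := [set a | eta a != None].

Definition restr (eta : pfun2) (x : set mu) : pfun2 :=
  fun a => if `[< x a >] then eta a else None.

Definition brestr (b : mu -> bool) (x : set mu) : pfun2 :=
  restr (fun a => Some (b a)) x.

(* Only the values of T on Psub kappa [set: mu] matter. *)
Definition is_tree (kappa : set mu) (T : set mu -> set pfun2) : Prop :=
  [/\ forall x, Psub kappa [set: mu] x ->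
        T x `<=` [set eta | dom eta = x] /\ T x !=set0,
      forall x y eta, Psub kappa [set: mu] x -> Psub kappa [set: mu] y ->
        x `<=` y -> T y eta -> T x (restr eta x) &
      forall x, Psub kappa [set: mu] x -> T x #< kappa].

Definition cofinal_branch (kappa : set mu) (T : set mu -> set pfun2)
    (b : mu -> bool) : Prop :=
  forall x, Psub kappa [set: mu] x -> T x (brestr b x).

Definition ladder_system (kappa : set mu) (T : set mu -> set pfun2)
    (L : set pfun2) : Prop :=
  [/\ L `<=` \bigcup_(x in Psub kappa [set: mu]) T x,
      club_many kappa [set: mu] (fun x => L `&` T x !=set0) &
      forall x eta, Psub kappa [set: mu] x -> (L `&` T x) eta ->
        ~~ countable (cof (cardinal (x `&` kappa) : set mu)) ->
        exists2 E, club (cardinal (x `&` kappa) : set mu) x E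
                 & [set restr eta y | y in E] `<=` L].

Definition meets_cofinally (kappa rho : set mu) (L : set pfun2)
    (b : mu -> bool) : Prop :=
  forall x, Psub rho [set: mu] x ->
    exists z, [/\ Psub kappa [set: mu] z, x `<=` z & L (brestr b z)].

Definition meets_club_often (rho : set mu) (L : set pfun2)
    (b : mu -> bool) : Prop :=
  club_many rho [set: mu] (fun x => L (brestr b x)).

Definition LSCP_clubs (kappa rho : set mu) : Prop :=
  forall T L, is_tree kappa T -> ladder_system kappa T L ->
    exists2 b, cofinal_branch kappa T b & meets_club_often rho L b.

Definition LSCP_cofinally (kappa rho : set mu) : Prop :=
  forall T L, is_tree kappa T -> ladder_system kappa T L ->
    exists2 b, cofinal_branch kappa T b & meets_cofinally kappa rho L b.

End Trees.

(* First order logic with equality; constants are 0-ary function symbols. *)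
Record language := Language {
  fsym : Type;
  rsym : Type;
  far : fsym -> nat;
  rar : rsym -> nat }.

Section Logic.
Variable L : language.

Inductive term : Type :=
  | Var of nat
  | App (f : fsym L) of ('I_(far f) -> term).

Inductive formula : Type :=
  | Fal
  | Eq of term & term
  | Rel (r : rsym L) of ('I_(rar r) -> term)
  | Imp of formula & formula
  | All of nat & formula.

Fixpoint tfree (n : nat) (t : term) : Prop :=
  match t with
  | Var m => m = n
  | App f ts => exists i, tfree n (ts i)
  end.

Fixpoint free (n : nat) (phi : formula) : Prop :=
  match phi with
  | Fal => False
  | Eq t u => tfree n t \/ tfree n u
  | Rel r ts => exists i, tfree n (ts i)
  | Imp phi psi => free n phi \/ free n psi
  | All m phi => n <> m /\ free n phi
  end.

Definition sentence : set formula := [set phi | forall n, ~ free n phi].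

Definition formula_in (x : nat) : set formula :=
  [set phi | forall n, free n phi -> n = x].

Record structure := Structure {
  carrier : Type;
  carrier_inhabited : inhabited carrier;
  finterp : forall f : fsym L, ('I_(far f) -> carrier) -> carrier;
  rinterp : forall r : rsym L, ('I_(rar r) -> carrier) -> Prop }.

Section Semantics.
Variable A : structure.

Fixpoint eval (v : nat -> carrier A) (t : term) : carrier A :=
  match t with
  | Var n => v n
  | App f ts => finterp (fun i => eval v (ts i))
  end.

Definition upd (v : nat -> carrier A) (n : nat) (a : carrier A) :=
  fun m => if m == n then a else v m.

Fixpoint sat (v : nat -> carrier A) (phi : formula) : Prop :=
  match phi with
  | Fal => False
  | Eq t u => eval v t = eval v u
  | Rel r ts => rinterp (fun i => eval v (ts i))
  | Imp phi psi => sat v phi -> sat v psi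
  | All n phi => forall a, sat (upd v n a) phi
  end.

Definition models (T : set formula) : Prop :=
  forall phi, T phi -> forall v, sat v phi.

Definition realizes (x : nat) (p : set formula) (a : carrier A) : Prop :=
  forall phi, p phi -> forall v, v x = a -> sat v phi.

Definition omits (x : nat) (p : set formula) : Prop :=
  forall a, ~ realizes x p a.

End Semantics.
End Logic.

(* The parts T' and p' of an element Z of P_kappa(T `|` p) are Z `&` T and
   Z `&` p.  The language has size mu. *)
Definition compactness_with_type_omission {d} {mu : orderType d}
    (kappa : set mu) : Prop :=
  forall (L : language) (x : nat) (T p : set (formula L)),
    [set: fsym L + rsym L] #= [set: mu] ->
    T `<=` @sentence L -> p `<=` @formula_in L x ->
    club_many kappa (T `|` p) (fun Z =>
      exists A : structure L, models A (Z `&` T) /\ omits A x (Z `&` p)) ->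
    exists A : structure L, models A T /\ omits A x p.

(* Main.v *)
Require Import Defs.
From mathcomp Require Import all_boot all_order all_classical.
From mathcomp Require Import wochoice.
Set Implicit Arguments.
Unset Strict Implicit.
Unset Printing Implicit Defensive.
Import Defs.
Import Order.TTheory.
Local Open Scope classical_set_scope.
Local Open Scope card_scope.

(** A branch that meets a ladder system on a club meets it cofinally, so the
    content is in two constructions, one for each remaining implication.

    From catching ladders cofinally to compactness.  Let [henkin L] be the
    Henkin terms over [L] and call a pair of a formula and an assignment of
    Henkin terms to variables a point.  Since mu ^ (< kappa) = mu there are
    at most mu points, so a function from mu to 2 is a truth value for every
    point.  The tree consists of all functions from x to 2, which are fewer than
    kappa because kappa is inaccessible, and the ladder system
    [henkin_ladder] of those which are the truth of the points of x in some
    structure satisfying the part of T in x, and in which each Henkin term of x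
    is kept from realizing p by a formula that also lies in x.  The first
    requirement is inherited by subsets and the second one by the subsets closed
    under one function, which form a club ([henkin_ladder_club]); the club of
    approximations given by the hypothesis makes the ladders frequent
    ([henkin_ladder_often]).  Every countable part of a branch that meets this
    system cofinally comes from a structure, hence the branch is the
    theory of the structure of Henkin terms modulo the equality it asserts
    ([term_model_truth]), which satisfies T and omits p.

    From compactness to catching ladders on a club.  For a tree Tr with a ladder
    system La consider, for a typical z in P_kappa mu and eta in La on z, the
    structure whose elements are the ordinals in z, all of them named by
    constants, together with the subsets y of z in a club on which eta restricts
    to elements of La.  The sentences true in all these structures, as soon as z
    contains the ordinals they speak of, form a theory, and a single type
    expresses that an element is an ordinal without a name or a set on which the
    branch follows a node outside La: each set y carries an index, and the type
    speaks of the node with that index.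
    In a model of the theory omitting the type the ordinals are exactly mu, so
    it defines a function b from mu to 2, which is a branch of Tr, and a family
    of subsets of mu on which b stays in La.

    The family must be a club of P_kappa mu, but it exists in the approximation
    z only if the cofinality of |z `&` kappa| is uncountable, and is closed only
    under unions of length below that cofinality.  So the cofinality is made
    part of the structure: a predicate D for an initial segment of kappa, and a
    function G from D to an unbounded subset of kappa.  All properties of the
    family are stated under the assumption that omega is in D, and closure only
    for lengths in D.  In the final model kappa is the true kappa, which
    is regular, and therefore D is all of kappa ([D_all]). *)

(** * Comparing cardinalities *)

Lemma card_le_of_inj T U (A : set T) (B : set U) (f : T -> U) :
  (forall x, A x -> B (f x)) ->
  (forall x y, A x -> A y -> f x = f y -> x = y) -> A #<= B.
Proof.
move=> fAB finj.
have e : f @` A #= A by apply: inj_card_eq => x y; rewrite !inE; exact: finj.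
rewrite -(card_le_eql e); apply: subset_card_le => _ [x Ax <-]; exact: fAB.
Qed.

Lemma card_le_of_surj T U (A : set T) (B : set U) (f : U -> T) :
  (forall x, A x -> exists2 y, B y & f y = x) -> A #<= B.
Proof.
move=> fs; apply: card_le_trans (card_image_le f B).
by apply: subset_card_le => x /fs[y By <-]; exists y.
Qed.

Lemma card_le_ex_inj T U (u0 : U) (A : set T) (B : set U) : A #<= B ->
  exists2 f : T -> U, (forall x, A x -> B (f x)) &
    forall x y, A x -> A y -> f x = f y -> x = y.
Proof.
elim/Ppointed: U => U' in B u0 *; first by case: (no u0).
move=> /pcard_leP/injfunPex[f fAB fi].
by exists f => // x y Ax Ay; apply: fi; rewrite inE.
Qed.

Lemma card_le_ex_surj T U (t0 : T) (A : set T) (B : set U) : A #<= B ->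
  exists f : U -> T, forall x, A x -> exists2 y, B y & f y = x.
Proof.
elim/Ppointed: T => T' in A t0 *; first by case: (no t0).
move=> /pcard_surjP[g gs].
by exists g => x /gs[y By <-]; exists y.
Qed.

Lemma card_lt_leW T U (A : set T) (B : set U) : A #< B -> A #<= B.
Proof. by case/andP. Qed.

Lemma card_lt_geF T U (A : set T) (B : set U) : A #< B -> ~ (B #<= A).
Proof. by case/andP => _ /negP. Qed.

Lemma card_ltP T U (A : set T) (B : set U) : A #<= B -> ~ (B #<= A) -> A #< B.
Proof. by move=> AB nBA; apply/andP; split=> //; apply/negP. Qed.

Lemma card_le_lt_trans T U V (A : set T) (B : set U) (C : set V) :
  A #<= B -> B #< C -> A #< C.
Proof.
move=> AB BC; apply: card_ltP; first exact: card_le_trans AB (card_lt_leW BC).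
by move=> CA; exact: card_lt_geF BC (card_le_trans CA AB).
Qed.

Lemma card_lt_le_trans T U V (A : set T) (B : set U) (C : set V) :
  A #< B -> B #<= C -> A #< C.
Proof.
move=> AB BC; apply: card_ltP; first exact: card_le_trans (card_lt_leW AB) BC.
by move=> CA; exact: card_lt_geF AB (card_le_trans BC CA).
Qed.

Lemma finite_lt_infinite T U (A : set T) (B : set U) :
  finite_set A -> infinite_set B -> A #< B.
Proof.
move=> fA iB; apply: card_ltP.
  apply: card_le_trans (finite_set_countable fA) _; exact/infiniteP.
by move=> BA; apply: iB; exact: card_le_finite BA fA.
Qed.

Lemma card_eq_leW T U (A : set T) (B : set U) : A #= B -> A #<= B.
Proof. by case/card_eqPle. Qed.

(** Choosing new values as long as there are any: this one recursion gives both
    the enumeration of an arbitrary set along mu and the injection of the square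
    of an infinite segment into itself. *)
Lemma greedy_recursion {I T} (R : I -> I -> Prop) (wf : well_founded R) (B : set T)
    (t0 : T) :
  exists f : I -> T, forall i, (exists2 x, B x & forall j, R j i -> f j <> x) ->
    B (f i) /\ forall j, R j i -> f j <> f i.
Proof.
pose pick (P : set T) :=
  if pselect (exists x, P x) is left e then sval (cid e) else t0.
have pickP P x : P x -> P (pick P).
  by move=> Px; rewrite /pick; case: pselect => [e|[]]; [case: (cid e)|exists x].
pose f := Fix wf (fun=> T)
  (fun i rec => pick [set x | B x /\ forall j (h : R j i), rec j h <> x]).
have fE i : f i = pick [set x | B x /\ forall j, R j i -> f j <> x].
  rewrite /f Fix_eq // => j g g' gg'; suff -> : g = g' by [].
  by apply: functional_extensionality_dep => k; apply/funext => h; exact: gg'.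
exists f => i [x Bx nx]; rewrite fE.
exact: (pickP [set x | B x /\ forall j, R j i -> f j <> x] x (conj Bx nx)).
Qed.

(** * Well-ordered types *)

Section WellOrder.
Context {d : Order.disp_t} {mu : orderType d}.
Hypothesis mu_wo : well_order (fun a b : mu => (a <= b)%O).
Implicit Types (a b c m : mu) (rho : set mu).

Lemma wo_min (P : set mu) : P !=set0 ->
  exists2 m, P m & forall a, P a -> (m <= a)%O.
Proof.
case=> x Px; case: (mu_wo (A := [pred y | `[< P y >]])).
  by exists x; apply/asboolP.
by move=> m [[/asboolP Pm mlb] _]; exists m => // a Pa; apply: mlb; apply/asboolP.
Qed.

Lemma wf_of_min {T} (R : T -> T -> Prop) :
  (forall P : set T, P !=set0 -> exists2 m, P m & forall x, P x -> ~ R x m) ->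
  well_founded R.
Proof.
move=> minR x; apply: contrapT => nx.
have [|m nm mm] := minR [set x | ~ Acc R x]; first by exists x.
by apply: nm; constructor => y Rym; apply: contrapT => /mm.
Qed.

Lemma wo_lt_wf : well_founded (fun a b => (a < b)%O).
Proof.
apply: wf_of_min => P /wo_min[m Pm mm]; exists m => // x /mm.
by rewrite leNgt => /negP.
Qed.

Lemma seg_sub a b : (a <= b)%O -> seg a `<=` seg b.
Proof. by move=> ab c /lt_le_trans; apply. Qed.

(** Enumerating A greedily along mu either never stops, and then mu embeds in A,
    or exhausts A at some a. *)
Lemma card_seg_total {T} (A : set T) :
  [set: mu] #<= A \/ exists a, A #= seg a.
Proof.
have [A0|/set0P[t0 At0]] := eqVneq A set0.
  case: (pselect (exists a : mu, True)) => [[a _]|nomu]; last first.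
    left; rewrite (_ : [set: mu] = set0) //; apply/seteqP; split => // a _.
    by case: nomu; exists a.
  right; have [|m _ mm] := @wo_min setT; first by exists a.
  exists m; rewrite A0 (_ : seg m = set0) ?card_eq00 //.
  by apply/seteqP; split => // b; rewrite /seg /= ltNge mm.
have [f fP] := greedy_recursion wo_lt_wf A t0.
pose free a := exists2 x, A x & forall b, (b < a)%O -> f b <> x.
have finj a b : free a -> free b -> f a = f b -> a = b.
  move=> /fP[_ fa] /fP[_ fb] e; case: (ltgtP a b) => // [/fb|/fa]; last by rewrite e.
  by [].
case: (pselect (forall a, free a)) => [allfree|/existsNP/wo_min[a nfa amin]].
  by left; apply: (@card_le_of_inj _ _ _ _ f) => [a _|a b _ _];
    [case: (fP a (allfree a))|exact: finj].
have fr b : (b < a)%O -> free b.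
  by move=> ba; apply: contrapT => /amin; rewrite leNgt ba.
right; exists a; apply: Cantor_Bernstein.
  apply: (@card_le_of_surj _ _ _ _ f) => x Ax; apply: contrapT => nx.
  by apply: nfa; exists x => // b ba e; apply: nx; exists b.
by apply: (@card_le_of_inj _ _ _ _ f) => [b /fr/fP[]|b c /fr ? /fr ?] //; exact: finj.
Qed.

Definition pair_max (p : mu * mu) := Order.max p.1 p.2.

(** The ordering of pairs for which the predecessors of a pair lie in the square
    of a proper initial segment. *)
Definition pair_lt (p q : mu * mu) : Prop :=
  (pair_max p < pair_max q)%O \/ (pair_max p = pair_max q /\
    ((p.1 < q.1)%O \/ (p.1 = q.1 /\ (p.2 < q.2)%O))).

Lemma pair_lt_wf : well_founded pair_lt.
Proof.
apply: wf_of_min => P [q Pq].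
have [|m [p1 Pp1 m1] mm] := @wo_min (pair_max @` P).
  by exists (pair_max q), q.
have [|m' [p2 [Pp2 e2] m2] mm'] := @wo_min (fst @` (P `&` [set p | pair_max p = m])).
  by exists p1.1, p1.
have [|m'' [p3 [[Pp3 e3] e3'] m3] mm''] :=
    @wo_min (snd @` (P `&` [set p | pair_max p = m] `&` [set p | p.1 = m'])).
  by exists p2.2, p2.
exists p3 => // r Pr [|[er]].
  by rewrite e3 ltNge mm //; exists r.
rewrite /= in e3 e3'.
case=> [|[er']].
  by rewrite e3' ltNge mm' //; exists r => //; split=> //; rewrite /= er.
rewrite m3 ltNge mm'' //; exists r => //; split => /=; last by rewrite er'.
by split => //=; rewrite er.
Qed.

Lemma pair_lt_total p q : p <> q -> pair_lt p q \/ pair_lt q p.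
Proof.
case: p q => [p1 p2] [q1 q2] npq; rewrite /pair_lt /=.
have [e0|e0|e0] := ltgtP (pair_max (p1, p2)) (pair_max (q1, q2));
  [by left; left|by right; left|].
have [e1|e1|e1] := ltgtP p1 q1;
  [by left; right; split; [|left]|by right; right; split; [|left]|].
have [e2|e2|e2] := ltgtP p2 q2; first by left; right; split; [|right].
  by right; right; split; [|right].
by case: npq; rewrite e1 e2.
Qed.

Lemma card_le_setX T U T' U' (A : set T) (B : set U) (A' : set T') (B' : set U') :
  A #<= A' -> B #<= B' -> A `*` B #<= A' `*` B'.
Proof.
move=> AA' BB'; have [->|/set0P[[a b] [/= Aa Bb]]] := eqVneq (A `*` B) set0 => //.
have [f fP] := card_le_ex_surj a AA'; have [g gP] := card_le_ex_surj b BB'.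
apply: (@card_le_of_surj _ _ _ _ (fun p => (f p.1, g p.2))) => -[x y].
move=> [/= /fP[x' Ax' <-] /gP[y' By' <-]].
by exists (x', y').
Qed.

(** Hessenberg's theorem.  One may assume that no earlier segment is as large as
    [seg m].  By induction a pair below m then has fewer predecessors for
    [pair_lt] than [seg m] has elements, so a greedy injection of the square
    into [seg m] never gets stuck. *)
Lemma card_square_seg m : infinite_set (seg m) -> seg m `*` seg m #<= seg m.
Proof.
elim: (wo_lt_wf m) => {}m _ IH infm.
case: (pselect (exists2 b, (b < m)%O & seg m #<= seg b)) => [[b bm mb]|small].
  have infb : infinite_set (seg b) by move=> fb; apply: infm; exact: card_le_finite mb fb.
  apply: card_le_trans (card_le_setX mb mb) _; apply: card_le_trans (IH b bm infb) _.
  by apply: subset_card_le; apply: seg_sub; exact: ltW.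
have [m0 mm0] := infinite_setN0 infm.
have [f fP] := greedy_recursion pair_lt_wf (seg m) m.
have key p : (seg m `*` seg m) p ->
    exists2 x, seg m x & forall q, pair_lt q p -> f q <> x.
  case=> p1 p2; apply: contrapT => nx.
  have cm : (pair_max p < m)%O by rewrite /pair_max gt_max; apply/andP; split.
  set c := pair_max p in cm; pose C := [set x | (x <= c)%O].
  have mC : seg m #<= C `*` C.
    (* the recursion is stuck at p only if the predecessors of p cover seg m *)
    apply: card_le_trans (_ : [set q | pair_lt q p] #<= _).
      apply: (@card_le_of_surj _ _ _ _ f) => x mx; apply: contrapT => nq.
      by apply: nx; exists x => // q qp e; apply: nq; exists q.
    apply: subset_card_le => q qp; have : (pair_max q <= c)%O.
      by case: qp => [/ltW //|[-> _]].
    by rewrite /pair_max ge_max => /andP[].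
  have [fC|iC] := pselect (finite_set C).
    by apply: infm; apply: card_le_finite mC _; exact: finite_setX.
  have CE : C = seg c `|` [set c].
    apply/seteqP; split=> x /=; rewrite /C /seg /= le_eqVlt.
      by case/orP => [/eqP|]; [right|left].
    by case=> [->|->]; rewrite ?orbT ?eqxx.
  have ic : infinite_set (seg c).
    by move=> fc; apply: iC; rewrite CE finite_setU; split => //; exact: finite_set1.
  have cc := IH c cm ic.
  have [u cu] := infinite_setN0 ic.
  have [v [cv uv]] : exists v, seg c v /\ u != v.
    apply: contrapT => nv; apply: ic; apply: (sub_finite_set (B := [set u]));
      last exact: finite_set1.
    move=> v cv /=; apply/eqP; apply: contrapT => vu; apply: nv; exists v; split=> //.
    by apply/negP => /eqP uv; apply: vu; rewrite uv.
  (* one more point fits in the square of seg c, hence in seg c *)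
  have Cc : C #<= seg c.
    apply: card_le_trans _ cc.
    apply: (@card_le_of_inj _ _ _ _ (fun x => if x == c then (u, v) else (x, u))).
      by move=> x; rewrite CE => -[/= xc|->]; rewrite ?eqxx ?(lt_eqF xc).
    move=> x y _ _; case: eqP => [->|_]; case: eqP => [->//|_] [] //.
      by move=> _ e; rewrite e eqxx in uv.
    by move=> _ e; rewrite e eqxx in uv.
  apply: small; exists c => //; apply: card_le_trans mC _.
  exact: card_le_trans (card_le_setX Cc Cc) cc.
apply: (@card_le_of_inj _ _ _ _ f) => [p /key/fP[]//|p q /key/fP[_ fp] /key/fP[_ fq] e].
by apply: contrapT => /pair_lt_total[/fq|/fp]; rewrite e.
Qed.

Lemma cardinal_down rho a b : cardinal rho = rho -> rho a -> (b <= a)%O -> rho b.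
Proof.
move=> <- ra ba; rewrite /cardinal /=; apply: card_le_lt_trans ra.
exact: subset_card_le (seg_sub ba).
Qed.

Lemma cardinal_seg_lt rho a : cardinal rho = rho -> rho a -> seg a #< rho.
Proof. by move=> rhoE ra; rewrite -{1}rhoE in ra. Qed.

Lemma card_lt_seg {T} (A : set T) rho : cardinal rho = rho -> A #< rho ->
  exists2 a, rho a & A #= seg a.
Proof.
move=> rhoE Ar; case: (card_seg_total A) => [muA|[a Aa]].
  by case: (card_lt_geF Ar); apply: card_le_trans muA; exact: card_leT.
exists a => //; rewrite -rhoE; apply: card_le_lt_trans Ar.
by case/card_eqPle: Aa.
Qed.

Lemma cof_sub rho : cardinal rho = rho -> cof rho `<=` rho.
Proof.
move=> rhoE a ca; rewrite -rhoE; apply: ca; split=> // b rb; by exists b.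
Qed.

(** The cardinal rho may be singular: the sizes of the F i are bounded below rho
    because there are fewer of them than its cofinality, and then the union
    embeds in the square of some m in rho. *)
Lemma bigcup_lt_cof {I T} rho (J : set I) (F : I -> set T) l :
  cardinal rho = rho -> infinite_set rho -> cof rho l -> J #<= seg l ->
  (forall i, J i -> F i #< rho) -> \bigcup_(i in J) F i #< rho.
Proof.
move=> rhoE irho cl Jl Frho.
have [->|/set0P[t0 [i0 _ _]]] := eqVneq (\bigcup_(i in J) F i) set0.
  by apply: finite_lt_infinite.
have /choice[s sP] : forall i, exists a, J i -> rho a /\ F i #= seg a.
  move=> i; case: (pselect (J i)) => [/Frho/(card_lt_seg rhoE)[a ra Fa]|nJ].
    by exists a.
  by exists l.
have [a ra sa] : exists2 a, rho a & forall i, J i -> (s i <= a)%O.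
  apply: contrapT => nob.
  have unb : unbounded rho (s @` J).
    split=> [_ [i /sP[? _] <-]//|a ra].
    apply: contrapT => na; apply: nob; exists a => // i Ji.
    case: (leP (s i) a) => // asi; case: na; exists (s i); first by exists i.
    exact: ltW.
  have /card_lt_geF := cl _ unb; apply.
  by apply: card_le_trans Jl; exact: card_image_le.
have rl := cof_sub rhoE cl.
set m := Order.max a l.
have rm : rho m by rewrite /m; case: (leP a l).
have am : seg a `<=` seg m by apply: seg_sub; rewrite le_max lexx.
have lm : seg l `<=` seg m by apply: seg_sub; rewrite le_max lexx orbT.
have le1 : \bigcup_(i in J) F i #<= J `*` seg m.
  have /choice[g gP] : forall i, exists g : mu -> T,
      J i -> forall x, F i x -> exists2 y, seg m y & g y = x.
    move=> i; case: (pselect (J i)) => [Ji|nJ]; last by exists (fun=> t0).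
    have [_ Fi] := sP i Ji; have [|g gP] := card_le_ex_surj t0 (B := seg m) (A := F i).
      apply: card_le_trans (subset_card_le am); apply: card_le_trans (card_eq_leW Fi) _.
      by apply: subset_card_le; apply: seg_sub; exact: sa.
    by exists g.
  apply: (@card_le_of_surj _ _ _ _ (fun p => g p.1 p.2)) => x [i Ji /(gP i Ji)[y my <-]].
  by exists (i, y).
have le2 : \bigcup_(i in J) F i #<= seg m `*` seg m.
  apply: card_le_trans le1 _; apply: card_le_setX => //.
  by apply: card_le_trans Jl _; exact: subset_card_le.
have [fm|im] := pselect (finite_set (seg m)).
  apply: finite_lt_infinite irho; apply: card_le_finite le2 _; exact: finite_setX.
apply: card_le_lt_trans (cardinal_seg_lt rhoE rm).
exact: card_le_trans le2 (card_square_seg im).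
Qed.

End WellOrder.

(** * Small sets, clubs and codes below an inaccessible *)

Section Inaccessible.
Context {d : Order.disp_t} {mu : orderType d} {kappa : set mu}.
Hypothesis mu_wo : well_order (fun a b : mu => (a <= b)%O).
Hypothesis kappa_inacc : inaccessible kappa.

Lemma kappa_cardinal : cardinal kappa = kappa.
Proof. by case: kappa_inacc => -[]. Qed.

Lemma kappa_cof : cof kappa = kappa.
Proof. by case: kappa_inacc => -[]. Qed.

Lemma kappa_infinite : infinite_set kappa.
Proof. by apply/infiniteP; case: kappa_inacc => -[]. Qed.

Lemma small_seg a : kappa a -> seg a #< kappa.
Proof. exact: cardinal_seg_lt kappa_cardinal. Qed.

Lemma small_finite T (A : set T) : finite_set A -> A #< kappa.
Proof. by move/finite_lt_infinite; apply; exact: kappa_infinite. Qed.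

Lemma small_sub T (A B : set T) : A `<=` B -> B #< kappa -> A #< kappa.
Proof. by move=> /subset_card_le; exact: card_le_lt_trans. Qed.

Lemma small_image T U (f : T -> U) (A : set T) : A #< kappa -> f @` A #< kappa.
Proof. by apply: card_le_lt_trans; exact: card_image_le. Qed.

Lemma small_bigcup I T (J : set I) (F : I -> set T) : J #< kappa ->
  (forall i, J i -> F i #< kappa) -> \bigcup_(i in J) F i #< kappa.
Proof.
move=> /(card_lt_seg mu_wo kappa_cardinal)[a ka Ja] FJ.
apply: (bigcup_lt_cof mu_wo kappa_cardinal kappa_infinite _ (card_eq_leW Ja) FJ).
by rewrite kappa_cof.
Qed.

Lemma small_setU T (A B : set T) : A #< kappa -> B #< kappa -> A `|` B #< kappa.
Proof.
move=> sA sB; rewrite (_ : _ `|` _ = \bigcup_(b in [set: bool]) if b then A else B).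
  by apply: small_bigcup => [|[]//]; exact: small_finite.
apply/seteqP; split=> x; first by case=> ?; [exists true|exists false].
by case=> -[] _ ?; [left|right].
Qed.

Lemma small_nat : [set: nat] #< kappa.
Proof.
by case: kappa_inacc => -[_ ? _] uk _; apply: card_ltP => // ku; move/negP: uk.
Qed.

Lemma omega_ex : exists w, [/\ kappa w, infinite_set (seg w),
  countable (seg w) & forall a, (a < w)%O -> finite_set (seg a)].
Proof.
have [w0 kw0 nw0] := card_lt_seg mu_wo kappa_cardinal small_nat.
have [|w iw wmin] := @wo_min _ _ mu_wo [set a | infinite_set (seg a)].
  by exists w0; apply/infiniteP; exact: card_eq_leW.
have ww0 : (w <= w0)%O.
  by apply: wmin; apply/infiniteP; exact: card_eq_leW.
exists w; split=> //.
- exact: cardinal_down kappa_cardinal kw0 ww0.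
- apply: card_le_trans (subset_card_le (seg_sub ww0)) _.
  by apply: card_eq_leW; rewrite card_eq_sym.
- by move=> a aw; apply: contrapT => /wmin; rewrite leNgt aw.
Qed.

(** Clubs are closed under unions of sequences indexed by segments of mu; a
    sequence indexed by nat is turned into one along omega, seen in mu, by a
    nondecreasing unbounded map [h] from omega to nat. *)
Lemma club_bigcup_nat T (X : set T) E (s : nat -> set T) : club kappa X E ->
  (forall n, E (s n)) -> (forall m n, (m <= n)%N -> s m `<=` s n) ->
  E (\bigcup_n s n).
Proof.
move=> [_ _ clE] sE smono; have [w [kw iw cw fw]] := omega_ex.
have [a0 a0w] := infinite_setN0 iw.
(* an enumeration of omega in no particular order; h a is the first index of a
   value above a *)
have [e eP ew] : exists2 e : nat -> mu,
    forall a, seg w a -> exists n, e n = a & forall n, seg w (e n).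
  have [e eP] := card_le_ex_surj a0 cw.
  exists (fun n => if `[< seg w (e n) >] then e n else a0) => [a wa|n].
    by have [n _ en] := eP a wa; exists n; rewrite asboolT en.
  by case: asboolP.
have ex_e a : exists n, seg w a -> (a <= e n)%O.
  case: (pselect (seg w a)) => [/eP[n en]|]; last by exists 0%N.
  by exists n; rewrite en.
pose h a := ex_minn (ex_intro (fun n => `[< seg w a -> (a <= e n)%O >])
  (sval (cid (ex_e a))) (introT (asboolP _) (svalP (cid (ex_e a))))).
have hP a : seg w a -> (a <= e (h a))%O.
  by move=> wa; rewrite /h; case: ex_minnP => n /asboolP/(_ wa).
have hmin a n : (seg w a -> (a <= e n)%O) -> (h a <= n)%N.
  by move=> an; rewrite /h; case: ex_minnP => m _; apply; apply/asboolP.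
have hmono a b : seg w b -> (a <= b)%O -> (h a <= h b)%N.
  by move=> wb ab; apply: hmin => _; apply: le_trans ab _; exact: hP.
have nomax a : seg w a -> exists2 b, seg w b & (a < b)%O.
  move=> wa; apply: contrapT => nb; apply: iw.
  apply: (@sub_finite_set _ _ (seg a `|` [set a])).
    move=> b wb; case: (ltgtP b a); [by left| |by right].
    by move=> ab; case: nb; exists b.
  by rewrite finite_setU; split; [exact: fw|exact: finite_set1].
have hunb n : exists2 a, seg w a & (n <= h a)%N.
  suff [a wa na] : exists2 a, seg w a & forall i, (i < n)%N -> (e i < a)%O.
    exists a => //; rewrite leqNgt; apply/negP => /na.
    by rewrite ltNge hP.
  elim: n => [|n [a wa IH]]; first by exists a0.
  have [b wb nb] := nomax _ (ew n).
  case: (leP a (e n)) => [an|na]; [exists b|exists a] => // i.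
    rewrite ltnS leq_eqVlt => /orP[/eqP ->//|/IH ia].
    exact: lt_trans (lt_le_trans ia an) nb.
  by rewrite ltnS leq_eqVlt => /orP[/eqP ->//|/IH].
suff -> : \bigcup_n s n = \bigcup_(a in seg w) s (h a).
  apply: clE => //; first by rewrite kappa_cof.
    by exists a0.
  by move=> a b wb ab; apply: smono; exact: hmono.
apply/seteqP; split=> x [i]; last by move=> _ ?; exists (h i).
by move=> _ sx; have [a wa ia] := hunb i; exists a => //; exact: smono ia _ sx.
Qed.

(** Clubs pull back along the map that sends Z to the union of the [S t] for t in
    Z.  This map preserves unions, so only unboundedness needs an argument: a
    member of C above the image of Z is covered by the image of a larger Z, and
    one alternates countably often, closing under R on the way.  Demanding [t0]
    makes the members nonempty. *)
Lemma club_pullback T U (X : set T) (Y : set U) C (S : T -> set U)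
    (R : T -> T -> set T) t0 :
  X t0 -> club kappa Y C -> (forall t, X t -> Psub kappa Y (S t)) ->
  (forall t t', X t -> X t' -> Psub kappa X (R t t')) ->
  (forall u, Y u -> exists2 t, X t & S t u) ->
  club kappa X [set Z | [/\ Psub kappa X Z, Z t0, C (\bigcup_(t in Z) S t) &
    forall t t', Z t -> Z t' -> R t t' `<=` Z]].
Proof.
move=> Xt0 clC SP RP surj; have [CP Ccof Ccl] := clC.
split=> [Z []//|Z0 Z0P|l s cl l0 sE smono]; last first.
  have UP : Psub kappa X (\bigcup_(a in seg l) s a).
    split; first by move=> t [a /sE[[sX _] _ _ _]] /sX.
    apply: small_bigcup => [|a /sE[[]]//].
    by apply: small_seg; rewrite -kappa_cof.
  split=> //.
  - by case: l0 => a la; exists a => //; case: (sE a la).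
  - suff -> : \bigcup_(t in \bigcup_(a in seg l) s a) S t =
      \bigcup_(a in seg l) (\bigcup_(t in s a) S t).
      apply: Ccl => // [a /sE[]//|a b lb ab u [t sa]].
      by exists t => //; exact: smono sa.
    apply/seteqP; split=> u; first by case=> t [a la sa] Su; exists a => //; exists t.
    by case=> a la [t sa Su]; exists t => //; exists a.
  - move=> t t' [a la sat] [b lb sbt'].
    have [c [lc ac bc]] : exists c, [/\ seg l c, (a <= c)%O & (b <= c)%O].
      by case: (leP a b) => ab; [exists b|exists a; split=> //; exact: ltW].
    have [_ _ _ Rc] := sE c lc; move=> v Rv; exists c => //.
    by apply: Rc Rv; [exact: smono sat|exact: smono sbt'].
pose SS Z := \bigcup_(t in Z) S t.
have SSP Z : Psub kappa X Z -> Psub kappa Y (SS Z).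
  move=> [ZX Zs]; split; first by move=> u [t /ZX/SP[SY _] /SY].
  by apply: small_bigcup => // t /ZX/SP[].
have step Z : exists Z', Psub kappa X Z -> [/\ Psub kappa X Z', Z `<=` Z', Z' t0,
    exists2 c, C c & SS Z `<=` c /\ c `<=` SS Z' &
    forall t t', Z t -> Z t' -> R t t' `<=` Z'].
  case: (pselect (Psub kappa X Z)) => [ZP|]; last by exists Z.
  have [c Cc Zc] := Ccof _ (SSP _ ZP); have [cY cs] := CP _ Cc.
  have /choice[g gP] : forall u, exists t, c u -> X t /\ S t u.
    by move=> u; case: (pselect (c u)) => [/cY/surj[t ? ?]|]; [exists t|exists t0].
  have [ZX Zs] := ZP.
  exists (Z `|` [set t0] `|` (g @` c `|` \bigcup_(t in Z) \bigcup_(t' in Z) R t t')).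
  move=> _; split.
  - split.
      move=> t [[/ZX//|->//]|[[u /gP[? _] <-//]|[v /ZX Xv [v' /ZX Xv' Rt]]]].
      by have [+ _] := RP _ _ Xv Xv'; apply.
    apply: small_setU; first by apply: small_setU => //; exact: small_finite.
    apply: small_setU; first exact: small_image.
    apply: small_bigcup => // t /ZX Xt; apply: small_bigcup => // t' /ZX Xt'.
    by have [_] := RP _ _ Xt Xt'.
  - by move=> t Zt; left; left.
  - by left; right.
  - exists c => //; split=> // u cu; exists (g u); last by case: (gP u cu).
    by right; left; exists u.
  - by move=> t t' Zt Zt' v Rv; right; right; exists t => //; exists t'.
have [f fP] := choice step.
pose Zn n := iter n f Z0.
have ZnP n : Psub kappa X (Zn n) by elim: n => [//|n /fP[]].
have Znmono m n : (m <= n)%N -> Zn m `<=` Zn n.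
  move=> /subnK <-; elim: (n - m)%N => [//|k IH].
  by apply: subset_trans IH _; have [] := fP _ (ZnP (k + m)%N).
have /choice[c cP] : forall n, exists c, C c /\ SS (Zn n) `<=` c /\ c `<=` SS (Zn n.+1).
  by move=> n; have [_ _ _ [c ? ?] _] := fP _ (ZnP n); exists c.
exists (\bigcup_n Zn n); last by move=> t Zt; exists 0%N.
split.
- split; first by move=> t [n _]; have [+ _] := ZnP n; apply.
  by apply: small_bigcup => [|n _]; [exact: small_nat|have [] := ZnP n].
- by exists 1%N => //; have [] := fP _ (ZnP 0%N).
- suff -> : \bigcup_(t in \bigcup_n Zn n) S t = \bigcup_n c n.
    apply: (club_bigcup_nat clC) => [n|m n]; first by case: (cP n).
    move=> /subnK <-; elim: (n - m)%N => [//|k IH].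
    apply: subset_trans IH _; have [_ [_ ck]] := cP (k + m)%N.
    by apply: subset_trans ck _; have [_ [+ _]] := cP (k.+1 + m)%N.
  apply/seteqP; split=> u.
    case=> t [n _ Zt] Su; exists n => //; have [_ [+ _]] := cP n; apply.
    by exists t.
  case=> n _; have [_ [_ +]] := cP n => /[apply] -[t Zt Su].
  by exists t => //; exists n.+1.
- move=> t t' [m _ Zm] [n _ Zn'] v Rv; exists (maxn m n).+1 => //.
  have [_ _ _ _ +] := fP _ (ZnP (maxn m n)); apply; last exact: Rv.
    by apply: Znmono Zm; exact: leq_maxl.
  by apply: Znmono Zn'; exact: leq_maxr.
Qed.

Section Codes.
Hypothesis mu_pow : [set: short_seqs kappa] #= [set: mu].

Lemma mu_inh : exists a : mu, True.
Proof. by have [a _] := infinite_setN0 kappa_infinite; exists a. Qed.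

(** A small set is the range of a short sequence. *)
Lemma card_small_sets T : [set: T] #<= [set: mu] ->
  [set x : set T | x #< kappa] #<= [set: mu].
Proof.
move=> Tmu; have [a0 _] := mu_inh.
have [f _ finj] := card_le_ex_inj a0 Tmu.
apply: card_le_trans (card_eq_leW mu_pow).
have /choice[g gP] : forall x : set T, exists s : short_seqs kappa,
   x #< kappa -> let: existT2 _ _ h := s in range h = f @` x.
  move=> x; case: (pselect (x #< kappa)) => [sx|]; last first.
    have [w [kw _ _ _]] := omega_ex.
    by exists (existT2 _ _ w kw (fun=> a0)).
  have [a ka xa] := card_lt_seg mu_wo kappa_cardinal (small_image f sx).
  have [h hb] : exists h : seg a -> f @` x, bijective h.
    by apply/card_bijP; rewrite card_eq_sym.
  exists (existT2 _ _ a ka (fun i => val (h i))) => _.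
  apply/seteqP; split=> y; first by case=> i _ <-; apply: set_mem; exact: valP.
  move=> fy; case: hb => k _ hk; exists (k (SigSub (mem_set fy))) => //.
  by rewrite hk.
apply: (@card_le_of_inj _ _ _ _ g) => // x y /gP + /gP + e; rewrite e.
case: (g y) => a ka h -> exy; apply/seteqP; split=> t.
  move=> xt; have : (f @` x) (f t) by exists t.
  by rewrite exy => -[t' yt' /finj <-].
move=> yt; have : (f @` y) (f t) by exists t.
by rewrite -exy => -[t' yt' /finj <-].
Qed.

(** An omega-sequence is a short sequence because kappa is uncountable. *)
Lemma card_sequences T : [set: T] #<= [set: mu] -> [set: nat -> T] #<= [set: mu].
Proof.
move=> Tmu; have [a0 _] := mu_inh.
case: (pselect (exists t : T, True)) => [[t0 _]|noT]; last first.
  rewrite (_ : [set: nat -> T] = set0) //; apply/seteqP; split=> // v _.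
  by case: noT; exists (v 0%N).
have [g gsurj] := card_le_ex_surj t0 Tmu.
apply: card_le_trans (card_eq_leW mu_pow).
have [w [kw /infiniteP iw _ _]] := omega_ex.
have [e ew einj] := card_le_ex_inj a0 iw.
pose rd (s : short_seqs kappa) n : T := let: existT2 a _ h := s in
  if pselect (e n \in seg a) is left p then g (h (SigSub p)) else t0.
apply: (@card_le_of_surj _ _ _ _ rd) => v _.
have /choice[r rP] : forall i, exists m, forall n, e n = i -> g m = v n.
  move=> i; case: (pselect (exists n, e n = i)) => [[n en]|]; last first.
    by move=> ni; exists a0 => n en; case: ni; exists n.
  have [y _ gy] := gsurj (v n) I; exists y => m em.
  by rewrite (einj m n) // em en.
exists (existT2 _ _ w kw (fun i : seg w => r (val i))) => //.
apply/funext => n; rewrite /rd; case: pselect => [p|[]].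
  exact: rP.
by rewrite inE; exact: ew.
Qed.

Lemma card_pairs T : [set: T] #<= [set: mu] -> [set: T * T] #<= [set: mu].
Proof.
move=> Tmu; apply: card_le_trans (card_sequences Tmu).
apply: (@card_le_of_inj _ _ _ _ (fun p n => if n == 0%N then p.1 else p.2)) => //.
move=> [x y] [x' y'] _ _ e.
by have := congr1 (@^~ 0%N) e; have /= -> := congr1 (@^~ 1%N) e => /= ->.
Qed.
End Codes.

End Inaccessible.

Section MoreCardinals.
Context {d : Order.disp_t} {mu : orderType d} {kappa : set mu}.
Hypothesis mu_wo : well_order (fun a b : mu => (a <= b)%O).
Hypothesis mu_card : is_cardinal [set: mu].
Hypothesis kappa_inacc : inaccessible kappa.

(** [cardinal A] is |A| as an initial ordinal; that mu is itself a cardinal covers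
    the sets of size |mu|, for which no element of mu stands for |A|. *)
Lemma card_cardinal T (A : set T) : A #<= [set: mu] ->
  (cardinal A : set mu) #= A.
Proof.
move=> Amu; case: (card_seg_total mu_wo A) => [muA|].
  suff -> : cardinal A = [set: mu] by exact: Cantor_Bernstein.
  apply/seteqP; split=> // a _; apply: card_lt_le_trans muA.
  exact: cardinal_seg_lt mu_card I.
move=> /(wo_min mu_wo)[a Aa amin]; suff -> : cardinal A = seg a by rewrite card_eq_sym.
apply/seteqP; split=> b.
  move=> /card_lt_geF nb; rewrite /seg /= ltNge; apply/negP => ab; apply: nb.
  by apply: card_le_trans (card_eq_leW Aa) (subset_card_le (seg_sub ab)).
move=> ba; apply: card_ltP.
  apply: card_le_trans (subset_card_le (seg_sub (ltW ba))) _.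
  by apply: card_eq_leW; rewrite card_eq_sym.
move=> Ab; have /amin : A #= seg b; last by rewrite leNgt ba.
apply: Cantor_Bernstein Ab _.
apply: card_le_trans (subset_card_le (seg_sub (ltW ba))) _.
by apply: card_eq_leW; rewrite card_eq_sym.
Qed.

Lemma cardinal_idem (A : set mu) : cardinal (cardinal A : set mu) = (cardinal A : set mu).
Proof.
have /card_eqPle[cA Ac] := card_cardinal (card_leT A).
by apply/seteqP; split=> a /card_lt_le_trans; apply.
Qed.

Lemma cof_down (rho : set mu) a b : cof rho a -> (b <= a)%O -> cof rho b.
Proof.
move=> ca ba C uC; apply: card_le_lt_trans (ca C uC).
exact: subset_card_le (seg_sub ba).
Qed.

Lemma uncountable_cof_omega (rho : set mu) w : ~~ countable (cof rho) ->
  countable (seg w) -> cof rho w.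
Proof.
move=> /negP uc cw; apply: contrapT => ncw; apply: uc.
apply: sub_countable cw; apply: subset_card_le => a ca.
by rewrite /seg /= ltNge; apply/negP => wa; apply: ncw; exact: cof_down ca wa.
Qed.

Lemma card_powerset T U (A : set T) (B : set U) : A #<= B ->
  [set X | X `<=` A] #<= [set X | X `<=` B].
Proof.
move=> AB; have [->|/set0P[t0 At0]] := eqVneq A set0.
  apply: (@card_le_of_inj _ _ _ _ (fun=> set0)) => [X XA|X Y] //=.
  by rewrite !subset0 => -> ->.
have [g gP] := card_le_ex_surj t0 AB.
apply: (@card_le_of_surj _ _ _ _ (fun Y => g @` Y)) => X XA.
exists (B `&` g @^-1` X); first by move=> y [].
apply/seteqP; split=> [_ [y [_ Xgy] <-]//|x Xx].
by have [y By gy] := gP x (XA x Xx); exists y => //; split=> //; rewrite /= gy.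
Qed.

Lemma small_powerset T (A : set T) : A #< kappa -> [set X | X `<=` A] #< kappa.
Proof.
move=> /(card_lt_seg mu_wo (kappa_cardinal kappa_inacc))[a ka Aa].
apply: card_le_lt_trans (card_powerset (card_eq_leW Aa)) _.
by case: kappa_inacc => _ _; apply.
Qed.

Lemma small_subsingleton T (A : set T) :
  (forall x y, A x -> A y -> x = y) -> A #< kappa.
Proof.
move=> A1; apply: (small_finite kappa_inacc).
have [->//|/set0P[x Ax]] := eqVneq A set0.
by apply: (sub_finite_set (B := [set x])) => // y Ay; exact: A1.
Qed.

Lemma lt_cof_finite_bigcup I T (J : set I) (F : I -> set T) (rho : set mu) :
  cardinal rho = rho -> ~~ countable (cof rho) -> finite_set J ->
  (forall i, J i -> F i #< rho) -> \bigcup_(i in J) F i #< rho.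
Proof.
move=> rhoE uc fJ; have [w [_ iw cw _]] := omega_ex mu_wo kappa_inacc.
have cofw := uncountable_cof_omega uc cw.
apply: (bigcup_lt_cof mu_wo rhoE _ cofw).
  move=> fr; move/negP: uc; apply; apply: finite_set_countable.
  exact: sub_finite_set (cof_sub rhoE) fr.
exact: card_lt_leW (finite_lt_infinite fJ iw).
Qed.

Section MoreCodes.
Hypothesis mu_pow : [set: short_seqs kappa] #= [set: mu].

Lemma card_le_prod T U : [set: T] #<= [set: mu] -> [set: U] #<= [set: mu] ->
  [set: T * U] #<= [set: mu].
Proof.
move=> Tmu Umu; rewrite -setXTT; apply: card_le_trans (card_le_setX Tmu Umu) _.
by rewrite setXTT; exact: (card_pairs mu_wo kappa_inacc mu_pow).
Qed.

Lemma card_nat_mu : [set: nat] #<= [set: mu].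
Proof.
apply: card_le_trans (card_lt_leW (small_nat kappa_inacc)) _; exact: card_leT.
Qed.

Lemma card_le_sum T U : [set: T] #<= [set: mu] -> [set: U] #<= [set: mu] ->
  [set: T + U] #<= [set: mu].
Proof.
move=> Tmu Umu; have [a0 _] := mu_inh kappa_inacc.
have [f _ fi] := card_le_ex_inj a0 Tmu; have [g _ gi] := card_le_ex_inj a0 Umu.
apply: card_le_trans (card_le_prod card_nat_mu (card_lexx [set: mu])).
apply: (@card_le_of_inj _ _ _ _ (fun s => match s with
  inl t => (0%N, f t) | inr u => (1%N, g u) end)) => //.
by move=> [t|u] [t'|u'] _ _ // [] => [/fi|/gi] ->.
Qed.

(** Trees of finite or countable branching are recovered from the labels along
    their finite paths, so they are bounded in number by these functions. *)
Lemma card_labellings T : [set: T] #<= [set: mu] ->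
  [set: seq nat -> T] #<= [set: mu].
Proof.
move=> Tmu; apply: card_le_trans (card_sequences mu_wo kappa_inacc mu_pow Tmu).
apply: (@card_le_of_surj _ _ _ _
  (fun (v : nat -> T) (s : seq nat) => v (choice.pickle s))).
move=> v _; exists (fun n => v (odflt [::] (choice.unpickle n))) => //.
by apply/funext => s; rewrite choice.pickleK.
Qed.
End MoreCodes.
End MoreCardinals.

(** * Henkin terms *)

Section Henkin.
Variable L : language.

(** [HWit n phi v] stands for a value of the variable n making phi false under v,
    if there is one.  The assignment v gives values to all variables, not only to
    those of phi; this makes the terms infinitary, but there are still at most
    |mu| of them and substitution of terms in formulas is never needed. *)
Inductive henkin : Type :=
  | HBase
  | HWit of nat & formula L & (nat -> henkin)
  | HApp (f : fsym L) of ('I_(far f) -> henkin).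

Fixpoint henkin_eval (v : nat -> henkin) (t : term L) : henkin :=
  match t with
  | Var n => v n
  | App f ts => HApp (fun i => henkin_eval v (ts i))
  end.

Definition henkin_upd (v : nat -> henkin) n h := fun m => if m == n then h else v m.

Definition label := (nat + (fsym L + rsym L))%type.

(** Paths that leave a term or formula get the label [inl 0]. *)
Definition branchings n (F : 'I_n -> seq nat -> label) (s : seq nat) : label :=
  if s is k :: s then (if insub k is Some i then F i s else inl 0) else inl 0.

Lemma branchings_inj n (F G : 'I_n -> seq nat -> label) :
  branchings F = branchings G -> F = G.
Proof.
move=> FG; apply/funext => i; apply/funext => s.
by have := congr1 (@^~ (val i :: s)) FG; rewrite /branchings valK.
Qed.

(** The labels along the paths from a node with a numerical tag: the symbol or
    number at the node is stored at the path [:: 0], and the subtrees under 1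
    and 2. *)
Definition code_node (tag : nat) (l : label) (c0 c1 : seq nat -> label)
    (s : seq nat) : label :=
  match s with
  | [::] => inl tag
  | 0%N :: _ => l
  | 1%N :: s => c0 s
  | _ :: s => c1 s
  end.

Lemma code_node_inj tag l c0 c1 tag' l' c0' c1' :
  code_node tag l c0 c1 = code_node tag' l' c0' c1' ->
  [/\ tag = tag', l = l', c0 = c0' & c1 = c1'].
Proof.
move=> e; split; [|by have := congr1 (@^~ [:: 0%N]) e| |].
- by have /= [] := congr1 (@^~ [::]) e.
- by apply/funext => s; have := congr1 (@^~ (1%N :: s)) e.
- by apply/funext => s; have := congr1 (@^~ (2%N :: s)) e.
Qed.

Let none (s : seq nat) : label := inl 0%N.

Fixpoint term_code (t : term L) : seq nat -> label :=
  match t with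
  | Var n => code_node 0 (inl n) none none
  | App f ts => code_node 1 (inr (inl f)) (branchings (fun i => term_code (ts i))) none
  end.

Fixpoint formula_code (phi : formula L) : seq nat -> label :=
  match phi with
  | Fal => code_node 0 (inl 0) none none
  | Eq t u => code_node 1 (inl 0) (term_code t) (term_code u)
  | Rel r ts => code_node 2 (inr (inr r)) (branchings (fun i => term_code (ts i))) none
  | Imp phi psi => code_node 3 (inl 0) (formula_code phi) (formula_code psi)
  | All n phi => code_node 4 (inl n) (formula_code phi) none
  end.

Definition sequence_code (F : nat -> seq nat -> label) (s : seq nat) : label :=
  if s is k :: s then F k s else inl 0.

Fixpoint henkin_code (h : henkin) : seq nat -> label :=
  match h with
  | HBase => code_node 0 (inl 0) none none
  | HWit n phi v =>
      code_node 1 (inl n) (formula_code phi) (sequence_code (fun k => henkin_code (v k)))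
  | HApp f hs => code_node 2 (inr (inl f)) (branchings (fun i => henkin_code (hs i))) none
  end.

Lemma term_code_inj : injective term_code.
Proof.
elim=> [n|f ts IH] [m|g us] /code_node_inj[] // _ [].
  by move=> -> _ _.
move=> fg; case: g / fg us => us /branchings_inj e _; congr App.
by apply/funext => i; apply: IH; exact: (congr1 (@^~ i) e).
Qed.

Lemma formula_code_inj : injective formula_code.
Proof.
elim=> [|t u|r ts|phi IH psi IH'|n phi IH]
  [|t' u'|r' ts'|phi' psi'|n' phi'] //= /code_node_inj[] //.
- by move=> _ _ /term_code_inj -> /term_code_inj ->.
- move=> _ [e]; case: r' / e ts' => ts' /branchings_inj e _; congr Rel.
  by apply/funext => i; apply: term_code_inj; exact: (congr1 (@^~ i) e).
- by move=> _ _ /IH -> /IH' ->.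
- by move=> _ [->] /IH ->.
Qed.

Lemma henkin_code_inj : injective henkin_code.
Proof.
elim=> [|n phi v IH|f hs IH] [|n' phi' v'|f' hs'] //= /code_node_inj[] //.
- move=> _ [->] /formula_code_inj -> e; congr HWit; apply/funext => k; apply: IH.
  by apply/funext => s; exact: (congr1 (@^~ (k :: s)) e).
- move=> _ [e]; case: f' / e hs' => hs' /branchings_inj e _; congr HApp.
  by apply/funext => i; apply: IH; exact: (congr1 (@^~ i) e).
Qed.

Lemma eval_ext (A : structure L) (v w : nat -> carrier A) t :
  (forall n, tfree n t -> v n = w n) -> eval v t = eval w t.
Proof.
elim: t => [n|f ts IH] /= vw; first exact: vw.
by congr finterp; apply/funext => i; apply: IH => n fn; apply: vw; exists i.
Qed.

Lemma sat_ext (A : structure L) phi (v w : nat -> carrier A) :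
  (forall n, free n phi -> v n = w n) -> sat v phi <-> sat w phi.
Proof.
elim: phi v w => [|t u|r ts|phi IH psi IH'|n phi IH] v w vw //=.
- by rewrite !(@eval_ext _ v w) // => n fn; apply: vw; [right|left].
- have -> : (fun i => eval v (ts i)) = (fun i => eval w (ts i)) => //.
  by apply/funext => i; apply: eval_ext => n fn; apply: vw; exists i.
- have e : sat v phi <-> sat w phi by apply: IH => n fn; apply: vw; left.
  have e' : sat v psi <-> sat w psi by apply: IH' => n fn; apply: vw; right.
  by rewrite (propext e) (propext e').
- by split=> s a; apply/(IH (upd v n a) (upd w n a)) => // m fm;
    rewrite /upd; case: eqP => // mn; apply: vw.
Qed.

End Henkin.

Section HenkinValue.
Variables (L : language) (A : structure L).
Variables (wit : nat -> formula L -> (nat -> carrier A) -> carrier A).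
Variable a0 : carrier A.

(** The choice of counterexamples that interprets [HWit]. *)
Definition witnessing := forall n phi v,
  sat (upd v n (wit n phi v)) phi -> sat v (All n phi).

Fixpoint henkin_val (h : henkin L) : carrier A :=
  match h with
  | HBase => a0
  | HWit n phi v => wit n phi (fun k => henkin_val (v k))
  | HApp f hs => finterp (fun i => henkin_val (hs i))
  end.

Lemma henkin_val_eval v t : henkin_val (henkin_eval v t) = eval (henkin_val \o v) t.
Proof.
by elim: t => [//|f ts IH] /=; congr finterp; apply/funext => i; exact: IH.
Qed.

Lemma henkin_val_upd v n h :
  henkin_val \o henkin_upd v n h = upd (henkin_val \o v) n (henkin_val h).
Proof. by apply/funext => m; rewrite /henkin_upd /upd /=; case: eqP. Qed.

Definition truth (q : formula L * (nat -> henkin L)) : Prop :=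
  sat (henkin_val \o q.2) q.1.

(** The values of Henkin terms form an elementary substructure: a universal formula
    that fails, fails at the value of a Henkin term. *)
Lemma truth_all n phi v : witnessing ->
  truth (All n phi, v) <-> truth (phi, henkin_upd v n (HWit n phi v)).
Proof.
move=> witP; rewrite /truth /= henkin_val_upd; split=> [s|]; [exact: s|exact: witP].
Qed.

End HenkinValue.

Lemma witness_ex (L : language) (A : structure L) :
  exists2 wit : nat -> formula L -> (nat -> carrier A) -> carrier A,
    witnessing wit & exists a0 : carrier A, True.
Proof.
have [a0] := carrier_inhabited A.
have /choice[w wP] : forall q : nat * formula L * (nat -> carrier A), exists a,
    sat (upd q.2 q.1.1 a) q.1.2 -> sat q.2 (All q.1.1 q.1.2).
  move=> [[n phi] v] /=; case: (pselect (exists a, ~ sat (upd v n a) phi)).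
    by move=> [a na]; exists a => /na.
  by move=> na; exists a0 => _ a; apply: contrapT => s; apply: na; exists a.
exists (fun n phi v => w (n, phi, v)); last by exists a0.
by move=> n phi v; exact: (wP (n, phi, v)).
Qed.

(** * The structure of Henkin terms *)

Section TermModel.
Variables (L : language) (beta : formula L * (nat -> henkin L) -> Prop).

Variable T : set (formula L).
(** Each property of truth needed below involves countably many points only, so
    it passes from structures to beta. *)
Hypothesis beta_local : forall F : set (formula L * (nat -> henkin L)),
  countable F ->
  exists (A : structure L) wit (a0 : carrier A), [/\ witnessing wit,
    forall q, F q -> (beta q <-> truth wit a0 q) &
    forall phi v, F (phi, v) -> T phi -> forall w : nat -> carrier A, sat w phi].

Let pair_val (h h' : henkin L) (n : nat) := if n == 0%N then h else h'.
Let eqv h h' : Prop := beta (Eq (Var L 0) (Var L 1), pair_val h h').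

(** For the points that compare the values of two Henkin terms. *)
Let eqv_local (J : set (henkin L * henkin L)) F : countable J -> countable F ->
  exists (A : structure L) wit (a0 : carrier A), [/\ witnessing wit,
    forall q, F q -> (beta q <-> truth wit a0 q) &
    forall p, J p -> (eqv p.1 p.2 <-> henkin_val wit a0 p.1 = henkin_val wit a0 p.2)].
Proof.
move=> cJ cF.
have [|A [wit [a0 [witP bt _]]]] := @beta_local
  (F `|` (fun p => (Eq (Var L 0) (Var L 1), pair_val p.1 p.2)) @` J).
  rewrite (_ : _ `|` _ = \bigcup_(b in [set: bool]) if b then F else
    (fun p => (Eq (Var L 0) (Var L 1), pair_val p.1 p.2)) @` J).
    apply: bigcup_countable => // -[] _ //.
    by apply: sub_countable cJ; exact: card_image_le.
  apply/seteqP; split=> x; first by case=> ?; [exists true|exists false].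
  by case=> -[] _ ?; [left|right].
exists A, wit, a0; split=> // [q Fq|p Jp]; first by apply: bt; left.
by apply: bt; right; exists p.
Qed.

Let eqv_refl h : eqv h h.
Proof.
have [|//|A [wit [a0 [_ _ e]]]] := @eqv_local [set (h, h)] set0.
  by apply: finite_set_countable; exact: finite_set1.
by apply/(e (h, h)).
Qed.

Let eqv_eucl h1 h2 h3 : eqv h1 h2 -> eqv h1 h3 -> eqv h2 h3.
Proof.
have [|//|A [wit [a0 [_ _ e]]]] :=
  @eqv_local [set (h1, h2); (h1, h3); (h2, h3)] set0.
  by apply: finite_set_countable; exact: finite_set3.
move=> /(e (h1, h2))-/(_ (or_introl (or_introl erefl)))/= e12.
move=> /(e (h1, h3))-/(_ (or_introl (or_intror erefl)))/= e13.
by apply/(e (h2, h3)); [right|rewrite /= -e12].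
Qed.

Let eqv_sym h h' : eqv h h' -> eqv h' h.
Proof. by move=> e; exact: eqv_eucl e (eqv_refl h). Qed.

Let tm_carrier := {X : set (henkin L) | exists h, X = eqv h}.

Let cl h : tm_carrier := exist _ (eqv h) (ex_intro _ h erefl).

Let rp (X : tm_carrier) : henkin L := sval (cid (svalP X)).

Let cl_eq h h' : cl h = cl h' <-> eqv h h'.
Proof.
split=> [e|e]; last first.
  apply: eq_exist; apply/seteqP; split=> k; first exact: eqv_eucl e.
  exact: eqv_eucl (eqv_sym e).
by have /= -> := congr1 sval e; exact: eqv_refl.
Qed.

Let clK X : cl (rp X) = X.
Proof. by case: X => X hX; apply: eq_exist; rewrite /rp /=; case: cid. Qed.

Let rpK h : eqv (rp (cl h)) h. Proof. by apply/cl_eq; rewrite clK. Qed.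

Let app_eqv f (hs ks : 'I_(far f) -> henkin L) :
  (forall i, eqv (hs i) (ks i)) -> eqv (HApp hs) (HApp ks).
Proof.
move=> hk; have [||A [wit [a0 [_ _ e]]]] :=
  @eqv_local ([set (HApp hs, HApp ks)] `|` range (fun i => (hs i, ks i))) set0.
- apply: finite_set_countable; rewrite finite_setU; split; first exact: finite_set1.
  by apply: finite_image; exact: finite_finset.
- by [].
apply/(e (_, _)); first by left.
rewrite /=; congr finterp; apply/funext => i.
by apply/(e (hs i, ks i)); [right; exists i|exact: hk].
Qed.

Let extend n (g : 'I_n -> henkin L) k : henkin L :=
  if insub k is Some i then g i else HBase L.

Let extendE n (g : 'I_n -> henkin L) (i : 'I_n) : extend g i = g i.
Proof. by rewrite /extend valK. Qed.

(** An atomic formula on distinct variables, valued by the given terms; [extend]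
    fills in the variables that do not occur. *)
Let rel_point r (hs : 'I_(rar r) -> henkin L) : formula L * (nat -> henkin L) :=
  (Rel (fun i : 'I_(rar r) => Var L i), extend hs).

Let rel_eqv r (hs ks : 'I_(rar r) -> henkin L) :
  (forall i, eqv (hs i) (ks i)) -> beta (rel_point hs) -> beta (rel_point ks).
Proof.
move=> hk; have [||A [wit [a0 [_ bt e]]]] :=
  @eqv_local (range (fun i => (hs i, ks i))) [set rel_point hs; rel_point ks].
- by apply: finite_set_countable; apply: finite_image; exact: finite_finset.
- by apply: finite_set_countable; exact: finite_set2.
move=> /(bt (rel_point hs))-/(_ (or_introl erefl)) th.
apply/(bt (rel_point ks)); first by right.
move: th; rewrite /truth /rel_point /=; congr rinterp; apply/funext => i.
rewrite /= !extendE; apply/(e (hs i, ks i)); [by exists i|exact: hk].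
Qed.

Definition term_model : structure L := {|
  carrier := tm_carrier;
  carrier_inhabited := inhabits (cl (HBase L));
  finterp := fun f args => cl (HApp (fun i => rp (args i)));
  rinterp := fun r args => beta (rel_point (fun i => rp (args i))) |}.

Let tm_eval v t : eval (A := term_model) (cl \o v) t = cl (henkin_eval v t).
Proof.
elim: t => [//|f ts IH] /=; apply/cl_eq; apply: app_eqv => i.
by rewrite IH; exact: rpK.
Qed.

Let cl_hupd v n h : upd (A := term_model) (cl \o v) n (cl h) = cl \o henkin_upd v n h.
Proof. by apply/funext => m; rewrite /henkin_upd /upd /=; case: eqP. Qed.

Lemma term_model_truth phi v :
  sat (A := term_model) (cl \o v) phi <-> beta (phi, v).
Proof.
elim: phi v => [|t u|r ts|phi IH psi IH'|n phi IH] v /=.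
- have [|A [wit [a0 [_ bt _]]]] := @beta_local [set (Fal L, v)].
    by apply: finite_set_countable; exact: finite_set1.
  by split=> // /bt-/(_ erefl).
- rewrite !tm_eval cl_eq.
  have [||A [wit [a0 [_ bt e]]]] :=
    @eqv_local [set (henkin_eval v t, henkin_eval v u)] [set (Eq t u, v)];
    try by apply: finite_set_countable; exact: finite_set1.
  by rewrite (propext (e _ erefl)) (propext (bt _ erefl)) /truth /= !henkin_val_eval.
- have -> : beta (Rel ts, v) = beta (rel_point (fun i => henkin_eval v (ts i))).
    apply: propext.
    have [|A [wit [a0 [_ bt _]]]] := @beta_local
        [set (Rel ts, v); rel_point (fun i => henkin_eval v (ts i))].
      by apply: finite_set_countable; exact: finite_set2.
    rewrite (propext (bt (Rel ts, v) (or_introl erefl))).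
    rewrite (propext (bt (rel_point (fun i => henkin_eval v (ts i))) (or_intror erefl))).
    rewrite /truth /=; suff -> : (fun i => eval (henkin_val wit a0 \o v) (ts i)) =
      (fun i => henkin_val wit a0 (extend (fun i => henkin_eval v (ts i)) i)) by [].
    by apply/funext => i; rewrite extendE henkin_val_eval.
  by split; apply: rel_eqv => i; rewrite tm_eval; [exact: rpK|apply: eqv_sym; exact: rpK].
- rewrite (propext (IH v)) (propext (IH' v)).
  have [|A [wit [a0 [_ bt _]]]] := @beta_local
      [set (phi, v); (psi, v); (Imp phi psi, v)].
    by apply: finite_set_countable; exact: finite_set3.
  by rewrite (propext (bt (phi, v) (or_introl (or_introl erefl))))
    (propext (bt (psi, v) (or_introl (or_intror erefl))))
    (propext (bt (Imp phi psi, v) (or_intror erefl))).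
- have sE : (forall a, sat (upd (A := term_model) (cl \o v) n a) phi) <->
      forall h, beta (phi, henkin_upd v n h).
    split=> s; first by move=> h; apply/IH; rewrite -cl_hupd; exact: s.
    by move=> X; rewrite -(clK X) cl_hupd; apply/IH; exact: s.
  apply: iff_trans sE _; split=> [s|ball h].
    have [|A [wit [a0 [witP bt _]]]] := @beta_local
        [set (phi, henkin_upd v n (HWit n phi v)); (All n phi, v)].
      by apply: finite_set_countable; exact: finite_set2.
    apply/bt; first by right.
    by apply/truth_all => //; apply/bt; [left|exact: s].
  have [|A [wit [a0 [witP bt _]]]] := @beta_local
      [set (phi, henkin_upd v n h); (All n phi, v)].
    by apply: finite_set_countable; exact: finite_set2.
  apply/bt; first by left.
  have /bt := ball => /(_ (or_intror erefl)) /(_ (henkin_val wit a0 h)).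
  by rewrite /truth /= henkin_val_upd.
Qed.

Lemma term_model_models : models term_model T.
Proof.
move=> phi Tphi v; have -> : v = cl \o (rp \o v) by apply/funext => n /=; rewrite clK.
apply/term_model_truth.
have [|A [wit [a0 [_ bt st]]]] := @beta_local [set (phi, rp \o v)].
  by apply: finite_set_countable; exact: finite_set1.
by apply/bt => //; exact: (st phi (rp \o v) erefl Tphi).
Qed.

(** Elements are classes of Henkin terms, and the assignment that is constantly h
    decides formulas about h, whatever their free variable is. *)
Lemma term_model_omits x (p : set (formula L)) :
  (forall h, exists2 phi, p phi & ~ beta (phi, fun=> h)) -> omits term_model x p.
Proof.
move=> bp X rX; have [phi pphi] := bp (rp X); apply; apply/term_model_truth.
by apply: rX => //=; rewrite clK.
Qed.

End TermModel.

(** * From ladder systems to compactness *)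

Section PartialFunctions.
Context {d : Order.disp_t} {mu : orderType d} {kappa : set mu}.
Hypothesis mu_wo : well_order (fun a b : mu => (a <= b)%O).
Hypothesis kappa_inacc : inaccessible kappa.

Lemma dom_restr (eta : @pfun2 _ mu) x : x `<=` dom eta -> dom (restr eta x) = x.
Proof.
move=> xd; apply/seteqP; split=> a; rewrite /dom /restr /=; first by case: asboolP.
by move=> xa; rewrite asboolT //; exact: xd.
Qed.

Lemma dom_brestr (b : mu -> bool) x : dom (brestr b x) = x.
Proof. by apply: dom_restr => a _. Qed.

Lemma brestrE (b : mu -> bool) x a : x a -> brestr b x a = Some (b a).
Proof. by move=> xa; rewrite /brestr /restr asboolT. Qed.

Lemma small_functions (x : set mu) : x #< kappa ->
  [set eta : @pfun2 _ mu | dom eta = x] #< kappa.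
Proof.
move=> sx; apply: card_le_lt_trans (small_powerset mu_wo kappa_inacc sx).
apply: (@card_le_of_inj _ _ _ _ (fun eta => [set a | eta a = Some true])).
  by move=> eta <- a /= e; rewrite /dom /= e.
move=> eta nu /= deta dnu e; apply/funext => a.
have := congr1 (fun A : set mu => A a) e; rewrite /= => {}e.
have dE : (eta a != None) = (nu a != None).
  apply/idP/idP => h.
    have xa : x a by rewrite -deta; exact: h.
    by rewrite -dnu in xa.
  have xa : x a by rewrite -dnu; exact: h.
  by rewrite -deta in xa.
move: dE; case: (eta a) e => [[]|]; case: (nu a) => [[]|] //= e _.
  by have : Some false = Some true by rewrite -e.
by have : Some false = Some true by rewrite e.
Qed.

Lemma full_tree_is_tree :
  is_tree kappa (fun x => [set eta : @pfun2 _ mu | dom eta = x]).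
Proof.
split=> [x [_ sx]|x y eta _ _ xy /= de|x [_ sx]]; last exact: small_functions.
  split=> //; exists (fun a => if `[< x a >] then Some true else None).
  by apply/seteqP; split=> a; rewrite /dom /=; case: asboolP.
by apply: dom_restr; rewrite de.
Qed.

End PartialFunctions.

Section LadderToCompactness.
Context {d : Order.disp_t} {mu : orderType d} {kappa : set mu}.
Hypothesis mu_wo : well_order (fun a b : mu => (a <= b)%O).
Hypothesis mu_card : is_cardinal [set: mu].
Hypothesis kappa_inacc : inaccessible kappa.
Hypothesis mu_pow : [set: short_seqs kappa] #= [set: mu].

Section Points.
Variable L : language.
Hypothesis L_mu : [set: fsym L + rsym L] #<= [set: mu].

Lemma card_labelled (X : Type) (code : X -> seq nat -> label L) :
  injective code -> [set: X] #<= [set: mu].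
Proof.
move=> ci; have lab : [set: label L] #<= [set: mu].
  exact: (card_le_sum mu_wo kappa_inacc mu_pow (card_nat_mu kappa_inacc) L_mu).
apply: card_le_trans (card_labellings mu_wo kappa_inacc mu_pow lab).
by apply: (@card_le_of_inj _ _ _ _ code) => // x y _ _ /ci.
Qed.

Lemma point_code_ex : exists c : formula L * (nat -> henkin L) -> mu, injective c.
Proof.
have [a0 _] := mu_inh kappa_inacc.
suff /(card_le_ex_inj a0)[c _ ci] :
    [set: formula L * (nat -> henkin L)] #<= [set: mu].
  by exists c => x y; exact: ci.
apply: (card_le_prod mu_wo kappa_inacc mu_pow).
  exact: card_labelled (@formula_code_inj L).
apply: (card_sequences mu_wo kappa_inacc mu_pow).
exact: card_labelled (@henkin_code_inj L).
Qed.

Variable c : formula L * (nat -> henkin L) -> mu.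
Hypothesis c_inj : injective c.
Variables (T p : set (formula L)) (x0 : nat).

Let opened h := c (Fal L, fun=> h).
Let instance phi h := c (phi, fun=> h).

Definition local_truth (x : set mu) (eta : @pfun2 _ mu) : Prop :=
  exists (A : structure L) wit (a0 : carrier A), [/\ witnessing wit,
    forall q, x (c q) -> (eta (c q) = Some true <-> truth wit a0 q) &
    forall phi v, x (c (phi, v)) -> T phi -> forall w : nat -> carrier A, sat w phi].

(** The point [opened h] announces that h has to be kept from realizing p. *)
Definition local_omission (x : set mu) (eta : @pfun2 _ mu) : Prop :=
  forall h, x (opened h) ->
    exists phi, [/\ p phi, x (instance phi h) & eta (instance phi h) <> Some true].

(** Local omission survives restriction to closed subsets only, so it could not be
    demanded of the nodes of a tree. *)
Definition henkin_ladder : set (@pfun2 _ mu) :=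
  [set eta | [/\ Psub kappa [set: mu] (dom eta), local_truth (dom eta) eta &
                 local_omission (dom eta) eta]].

Lemma local_truth_restr x y eta : y `<=` x -> local_truth x eta ->
  local_truth y (restr eta y).
Proof.
move=> yx [A [wit [a0 [witP tE TE]]]]; exists A, wit, a0; split=> // [q yq|phi v /yx].
  by rewrite /restr asboolT // tE //; exact: yx.
exact: TE.
Qed.

(** Restricting to y preserves truth; it preserves the local omission of the type
    when y is closed under the choice of a formula refuting each Henkin term.
    Closing once is enough, since the added points announce no further terms. *)
Lemma henkin_ladder_club x eta : Psub kappa [set: mu] x ->
  henkin_ladder eta -> dom eta = x ->
  ~~ countable (cof (cardinal (x `&` kappa) : set mu)) ->
  exists2 E, club (cardinal (x `&` kappa) : set mu) x E
             & [set restr eta y | y in E] `<=` henkin_ladder.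
Proof.
set rho : set mu := cardinal (x `&` kappa) => -[_ sx] [_ + +] deta uc.
rewrite deta => lt lo.
have rhoE : cardinal rho = rho by exact: (cardinal_idem mu_wo mu_card).
have srho T' (A : set T') : A #< rho -> A #< kappa.
  move=> /card_lt_le_trans; apply.
  apply: card_le_trans (card_eq_leW (card_cardinal mu_wo mu_card (card_leT _))) _.
  by apply: subset_card_le => a [].
exists [set y | Psub rho x y /\ local_omission y eta]; last first.
  move=> _ [y [[yx sy] lo'] <-].
  have dy : dom (restr eta y) = y by apply: dom_restr; rewrite deta.
  rewrite /henkin_ladder /= dy; split.
  - by split=> //; exact: srho.
  - exact: local_truth_restr lt.
  - by move=> h /lo'[phi [pphi yphi nphi]]; exists phi; rewrite /restr asboolT.
split=> [y []//|y [yx sy]|l s cl l0 sE smono].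
  have /choice[g gP] : forall a, exists a', forall h, x a -> a = opened h ->
      exists phi, [/\ p phi, a' = instance phi h, x a' & eta a' <> Some true].
    move=> a; case: (pselect (exists h, a = opened h)) => [[h ->]|nh]; last first.
      by exists a => h _ ah; case: nh; exists h.
    case: (pselect (x (opened h))) => [/lo[phi [? ? ?]]|nx]; last by exists a.
    exists (instance phi h) => h' _ /c_inj[] /(congr1 (@^~ 0%N)) <-.
    by exists phi.
  exists (y `|` [set a' | exists2 a, y a & g a = a' /\ exists h, a = opened h]);
    last by left.
  split.
    split.
      move=> a' [/yx//|[a /yx xa [<- [h ah]]]].
      by have [phi []] := gP a h xa ah.
    apply: (@card_le_lt_trans _ _ _ _ 
      (\bigcup_(b in [set: bool]) if b then y else g @` y)).
      apply: subset_card_le => a' [ya|[a ya [<- _]]]; first by exists true.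
      by exists false => //; exists a.
    apply: (lt_cof_finite_bigcup mu_wo kappa_inacc rhoE uc) => [|[]//].
      exact: finite_finset.
    by move=> _; apply: card_le_lt_trans sy; exact: card_image_le.
  suff key h : y (opened h) -> exists phi, [/\ p phi,
      (y `|` [set a' | exists2 a, y a & g a = a' /\ exists h, a = opened h])
        (instance phi h) & eta (instance phi h) <> Some true].
    move=> h [/key//|[a ya [ga [h' ah']]]].
    have [phi [pphi e xga eg]] := gP a h' (yx _ ya) ah'.
    (* an added point announces a term only if its formula is Fal, and then it is
       the announcement of the same term *)
    have [_ /(congr1 (@^~ 0%N)) /= eh] := c_inj (etrans (esym ga) e).
    by apply: key; rewrite eh -ah'.
  move=> yh; have [phi [pphi e _ ne]] := gP _ h (yx _ yh) erefl.
  exists phi; rewrite -e; split=> //; right; exists (opened h) => //; split=> //.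
  by exists h.
split; last first.
  move=> h [a la sa]; have [_ /(_ h sa)[phi [? ? ?]]] := sE a la.
  by exists phi; split=> //; exists a.
split; first by move=> t [a /sE[[+ _] _]]; apply.
have irho : infinite_set rho.
  move=> fr; move/negP: uc; apply; apply: finite_set_countable.
  exact: sub_finite_set (cof_sub rhoE) fr.
apply: (bigcup_lt_cof mu_wo rhoE irho cl) => // a /sE[[]] //.
Qed.

(** For x in the pulled back club, the formulas occurring at points of x form a
    member Z of the given club.  In a structure satisfying the sentences of Z and
    omitting its type, the truth of the points of x is a ladder: a term announced
    in x is refuted by a formula of Z, and x is closed under forming the point
    that says so. *)
Lemma henkin_ladder_often : p `<=` @formula_in L x0 ->
  club_many kappa (T `|` p) (fun Z =>
    exists A : structure L, models A (Z `&` T) /\ omits A x0 (Z `&` p)) ->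
  club_many kappa [set: mu] (fun x => exists2 eta, henkin_ladder eta & dom eta = x).
Proof.
move=> px0 [C clC CP].
pose S a := [set phi | (T `|` p) phi /\ exists v, a = c (phi, v)].
pose R a a' := [set m | exists phi v h,
  [/\ a = c (phi, v), a' = opened h & m = instance phi h]].
have small1 := small_subsingleton kappa_inacc.
exists [set x | [/\ Psub kappa [set: mu] x, x (opened (HBase L)),
    C (\bigcup_(t in x) S t) & forall t t', x t -> x t' -> R t t' `<=` x]].
  apply: (club_pullback mu_wo kappa_inacc _ clC) => // [t _|t t' _ _|phi Tphi].
  - split; first by move=> phi [].
    by apply: small1 => phi psi [_ [v ->]] [_ [w /c_inj[]]].
  - split=> //; apply: small1 => m m' [phi [v [h [-> -> ->]]]] [psi [w [k [e e' ->]]]].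
    have [-> _] := c_inj e; have [e2] := c_inj e'.
    by have /= -> := congr1 (@^~ 0%N) e2.
  - by exists (c (phi, fun=> HBase L)) => //; split=> //; exists (fun=> HBase L).
move=> x [xs _ /CP[A [AT Ap]] xR].
have [wit witP [a0 _]] := witness_ex A.
pose eta a := if `[< x a >] then
   Some `[< exists2 q, a = c q & truth wit a0 q >] else None.
have deta : dom eta = x.
  by apply/seteqP; split=> a; rewrite /dom /eta /=; case: asboolP.
have etaE q : x (c q) -> (eta (c q) = Some true <-> truth wit a0 q).
  move=> xq; rewrite /eta (asboolT xq); split.
    by case=> /asboolP[q' /c_inj ->].
  by move=> tq; rewrite asboolT //; exists q.
exists eta => //; split; rewrite deta //.
  exists A, wit, a0; split=> // phi v xphi Tphi w; apply: AT; split=> //.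
  by exists (c (phi, v)) => //; split; [left|exists v].
move=> h xh; have := Ap (henkin_val wit a0 h).
rewrite /realizes => /existsNP[phi /not_implyP[[[a xa [_ [v av]]] pphi]]].
move=> /existsNP[w /not_implyP[wh nw]].
have xi : x (instance phi h) by apply: (xR a _ xa xh); exists phi, v, h.
exists phi; split=> // /etaE-/(_ xi); rewrite /truth /= => s; apply: nw.
by apply/(sat_ext (v := w) (w := fun=> henkin_val wit a0 h)) => // n /(px0 _ pphi) ->.
Qed.

(** Cofinally many ladders suffice, because each instance of truth and each
    announced term concerns a small set of points. *)
Lemma henkin_branch_model (b : mu -> bool) :
  meets_cofinally kappa kappa henkin_ladder b ->
  exists A : structure L, models A T /\ omits A x0 p.
Proof.
move=> bL; pose beta q : Prop := b (c q).
have catch F : F #< kappa -> exists z, [/\ F `<=` z,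
    local_truth z (brestr b z) & local_omission z (brestr b z)].
  move=> sF; have [//|z [_ Fz []]] := bL F.
  by rewrite dom_brestr => _ lt lo; exists z.
have bE z q : z (c q) -> (brestr b z (c q) = Some true) = beta q.
  by move=> zq; rewrite brestrE // /beta; apply: propext; split=> [[]|->].
have beta_local F : countable F ->
    exists (A : structure L) wit (a0 : carrier A), [/\ witnessing wit,
    forall q, F q -> (beta q <-> truth wit a0 q) &
    forall phi v, F (phi, v) -> T phi -> forall w : nat -> carrier A, sat w phi].
  move=> cF; have [|z [Fz [A [wit [a0 [witP tE TE]]]] _]] := catch (c @` F).
    apply: (small_image (kappa := kappa)).
    exact: card_le_lt_trans cF (small_nat kappa_inacc).
  exists A, wit, a0; split=> // [q Fq|phi v Fphi].
    have zq : z (c q) by apply: Fz; exists q.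
    by rewrite -(bE z q zq); exact: tE.
  by apply: (TE phi v); apply: Fz; exists (phi, v).
exists (term_model beta); split; first exact: term_model_models beta_local.
apply: (term_model_omits beta_local) => h; have [|z [Fz _ lo]] := catch [set opened h].
  by apply: (small_finite kappa_inacc); exact: finite_set1.
have [phi [pphi zphi nphi]] := lo h (Fz _ erefl).
by exists phi => //; rewrite -(bE z _ zphi).
Qed.

End Points.

Theorem compactness_of_LSCP :
  LSCP_cofinally kappa kappa -> compactness_with_type_omission kappa.
Proof.
move=> lscp L x T p /card_eqPle[L_mu _] _ px clubT.
have [c c_inj] := point_code_ex L_mu.
have [||b _ bL] := lscp (fun x => [set eta | dom eta = x]) (henkin_ladder c T p).
- exact: full_tree_is_tree.
- split; first by move=> eta [deta _ _]; exists (dom eta).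
    have [E clE EP] := henkin_ladder_often c_inj px clubT.
    by exists E => // y /EP[eta Leta deta]; exists eta.
  by move=> y eta ys [Leta deta]; exact: henkin_ladder_club.
exact: henkin_branch_model bL.
Qed.

End LadderToCompactness.

(** * A language for trees *)

(** Elements of sort Y are sets of ordinals, all others are ordinals.  The
    relations are: B for the branch, K for kappa, D and G for the cofinality of
    kappa and a map witnessing it, Lt for the order of ordinals, E for membership
    of ordinals in sets, S for an enumeration of each set along an ordinal, and a
    binary relation [RC i] for each small relation coded by i. *)
Inductive relname (I : Type) : Type :=
  | RY | RB | RK | RD | RLt | RG | RE | RS | RC of I.
Arguments RY {I}.
Arguments RB {I}.
Arguments RK {I}.
Arguments RD {I}.
Arguments RLt {I}.
Arguments RG {I}.
Arguments RE {I}.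
Arguments RS {I}.

Definition relarity I (r : relname I) : nat :=
  match r with RY | RB | RK | RD => 1 | RLt | RG | RE | RC _ => 2 | RS => 3 end.

(** [Some a] is the constant a; [None] is the function sending a set to its
    index. *)
Definition tree_language (I : Type) : language :=
  @Language (option I) (relname I) (fun f => if f is Some _ then 0 else 1)
    (@relarity I).

Section Fragment.
Variable I : Type.
Let LL := tree_language I.

(** Formulas with quantifiers relativized to the two sorts ([QUAll] and [QUEx]
    range over ordinals, [QYAll] and [QYEx] over sets), whose meaning unfolds by
    computation to the proposition one would write.  The free variables and the
    symbols of the formulas [formula_of phi] are then computed as well. *)
Inductive qterm : Type := QV of nat | QC of I | QX of nat.

Inductive qf : Type :=
  | QR1 of relname I & qterm
  | QR2 of relname I & qterm & qterm
  | QR3 of relname I & qterm & qterm & qterm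
  | QEq of qterm & qterm
  | QFal
  | QImp of qf & qf
  | QAnd of qf & qf
  | QIff of qf & qf
  | QUAll of nat & qf
  | QUEx of nat & qf
  | QYAll of nat & qf
  | QYEx of nat & qf.

Definition QNot phi := QImp phi QFal.

Definition term_of (t : qterm) : term LL :=
  match t with
  | QV n => Var LL n
  | QC a => @App LL (Some a) (fun=> Var LL 0)
  | QX n => @App LL None (fun=> Var LL n)
  end.

Definition Not (phi : formula LL) := Imp phi (Fal LL).
Definition And (phi psi : formula LL) := Not (Imp phi (Not psi)).
Definition Ex n (phi : formula LL) := Not (All n (Not phi)).
Definition args2 (X : Type) n (x y : X) (i : 'I_n) := if val i == 0 then x else y.
Definition args3 (X : Type) n (x y z : X) (i : 'I_n) :=
  if val i == 0 then x else if val i == 1 then y else z.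
Definition isY (n : nat) : formula LL := @Rel LL RY (fun=> Var LL n).

Fixpoint formula_of (phi : qf) : formula LL :=
  match phi with
  | QR1 r t => @Rel LL r (fun=> term_of t)
  | QR2 r t u => @Rel LL r (args2 (term_of t) (term_of u))
  | QR3 r t u w => @Rel LL r (args3 (term_of t) (term_of u) (term_of w))
  | QEq t u => Eq (term_of t) (term_of u)
  | QFal => Fal LL
  | QImp phi psi => Imp (formula_of phi) (formula_of psi)
  | QAnd phi psi => And (formula_of phi) (formula_of psi)
  | QIff phi psi => And (Imp (formula_of phi) (formula_of psi))
                      (Imp (formula_of psi) (formula_of phi))
  | QUAll n phi => All n (Imp (Not (isY n)) (formula_of phi))
  | QUEx n phi => Ex n (And (Not (isY n)) (formula_of phi))
  | QYAll n phi => All n (Imp (isY n) (formula_of phi))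
  | QYEx n phi => Ex n (And (isY n) (formula_of phi))
  end.

Section Semantics.
Variable N : structure LL.

Definition const_val (a : I) : carrier N :=
  @finterp LL N (Some a) (fun i => False_rect _ (notF (ltn_ord i))).
Definition index_val (x : carrier N) : carrier N := @finterp LL N None (fun=> x).
Definition rel1 r x : Prop := @rinterp LL N r (fun=> x).
Definition rel2 r x y : Prop := @rinterp LL N r (args2 x y).
Definition rel3 r x y z : Prop := @rinterp LL N r (args3 x y z).

Definition qeval (v : nat -> carrier N) (t : qterm) : carrier N :=
  match t with QV n => v n | QC a => const_val a | QX n => index_val (v n) end.

(** The meaning of [formula_of phi], see [sat_formula_of]. *)
Fixpoint qsat (v : nat -> carrier N) (phi : qf) : Prop :=
  match phi with
  | QR1 r t => rel1 r (qeval v t)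
  | QR2 r t u => rel2 r (qeval v t) (qeval v u)
  | QR3 r t u w => rel3 r (qeval v t) (qeval v u) (qeval v w)
  | QEq t u => qeval v t = qeval v u
  | QFal => False
  | QImp phi psi => qsat v phi -> qsat v psi
  | QAnd phi psi => qsat v phi /\ qsat v psi
  | QIff phi psi => qsat v phi <-> qsat v psi
  | QUAll n phi => forall x, ~ rel1 RY x -> qsat (upd v n x) phi
  | QUEx n phi => exists x, ~ rel1 RY x /\ qsat (upd v n x) phi
  | QYAll n phi => forall x, rel1 RY x -> qsat (upd v n x) phi
  | QYEx n phi => exists x, rel1 RY x /\ qsat (upd v n x) phi
  end.

Lemma eval_term_of v t : eval v (term_of t) = qeval v t.
Proof.
case: t => [n|a|n] //=; rewrite /const_val.
by congr (@finterp LL N (Some a)); apply/funext => i; case: (notF (ltn_ord i)).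
Qed.

Lemma sat_and v phi psi : sat (A := N) v (And phi psi) = (sat v phi /\ sat v psi).
Proof.
apply: propext; split=> [/= s|[s s'] /=]; last by apply.
by split; apply: contrapT => n; apply: s.
Qed.

Lemma sat_ex v n phi : sat (A := N) v (Ex n phi) = exists a, sat (upd v n a) phi.
Proof.
apply: propext; split=> [/= s|[a s] /=]; last by move=> /(_ a); apply.
by apply: contrapT => ne; apply: s => a s; apply: ne; exists a.
Qed.

Lemma sat_all v n phi psi : sat (A := N) v (All n (Imp phi psi)) =
  forall a, sat (upd v n a) phi -> sat (upd v n a) psi.
Proof. by []. Qed.

Lemma sat_isY v n a : sat (A := N) (upd v n a) (isY n) = rel1 RY a.
Proof. by rewrite /rel1 /= /upd eqxx. Qed.

Lemma sat_formula_of phi v : sat (A := N) v (formula_of phi) = qsat v phi.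
Proof.
elim: phi v => [r t|r t u|r t u w|t u| |phi IH psi IH'|phi IH psi IH'|
  phi IH psi IH'|n phi IH|n phi IH|n phi IH|n phi IH] v;
  rewrite [formula_of _]/= ?sat_ex ?sat_and.
- by rewrite /= eval_term_of.
- rewrite /= /rel2; congr rinterp; apply/funext => i.
  by rewrite /args2; case: eqP => _; rewrite eval_term_of.
- rewrite /= /rel3; congr rinterp; apply/funext => i.
  by rewrite /args3; case: eqP => _; [|case: eqP => _]; rewrite eval_term_of.
- by rewrite /= !eval_term_of.
- by [].
- by rewrite /= IH IH'.
- by rewrite /= IH IH'.
- by rewrite /= IH IH'.
- rewrite sat_all [RHS]/=; apply: eq_forall => x.
  by rewrite -IH -(sat_isY v n x).
- by apply: eq_exists => x; rewrite sat_and IH -(sat_isY v n x).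
- rewrite sat_all [RHS]/=; apply: eq_forall => x.
  by rewrite -IH -(sat_isY v n x).
- by apply: eq_exists => x; rewrite sat_and IH -(sat_isY v n x).
Qed.

End Semantics.

Definition qtclosed (s : seq nat) (t : qterm) : bool :=
  match t with QV n | QX n => n \in s | QC _ => true end.

Fixpoint qclosed (s : seq nat) (phi : qf) : bool :=
  match phi with
  | QR1 _ t => qtclosed s t
  | QR2 _ t u | QEq t u => qtclosed s t && qtclosed s u
  | QR3 _ t u w => [&& qtclosed s t, qtclosed s u & qtclosed s w]
  | QFal => true
  | QImp phi psi | QAnd phi psi | QIff phi psi => qclosed s phi && qclosed s psi
  | QUAll n phi | QUEx n phi | QYAll n phi | QYEx n phi => qclosed (n :: s) phi
  end.

Lemma qtclosed_free s t n : qtclosed s t -> tfree n (term_of t) -> n \in s.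
Proof.
by case: t => [m|a|m] /= ms; [move=> <-|case=> i; case: (notF (ltn_ord i))|case=> _ <-].
Qed.

Ltac destruct_free := repeat match goal with
  | H : _ /\ _ |- _ => destruct H
  | H : _ \/ _ |- _ => destruct H
  | H : exists _, _ |- _ => destruct H
  | H : False |- _ => destruct H
  end.

Lemma qclosed_free phi s n : qclosed s phi -> free n (formula_of phi) -> n \in s.
Proof.
elim: phi s => [r t|r t u|r t u w|t u| |phi IH psi IH'|phi IH psi IH'|
  phi IH psi IH'|m phi IH|m phi IH|m phi IH|m phi IH] s /=;
  try (move=> cp fp; destruct_free; try congruence;
    match goal with H : free n (formula_of phi) |- _ =>
      by move: (IH _ cp H); rewrite inE => /orP[/eqP|] end).
- by move=> ct [_]; exact: qtclosed_free.
- move=> /andP[ct cu] [i]; rewrite /args2; case: eqP => _; exact: qtclosed_free.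
- move=> /and3P[ct cu cw] [i]; rewrite /args3.
  by case: eqP => _; [|case: eqP => _]; exact: qtclosed_free.
- by move=> /andP[ct cu] []; exact: qtclosed_free.
- by move=> /andP[cp cq] [/(IH _ cp)|/(IH' _ cq)].
- by move=> /andP[cp cq] fp; destruct_free; [exact: IH cp _|exact: IH' cq _].
- by move=> /andP[cp cq] fp; destruct_free; (exact: IH cp _ || exact: IH' cq _).
Qed.

Lemma qclosed_sentence phi : qclosed [::] phi -> sentence (formula_of phi).
Proof. by move=> cp n /(qclosed_free cp). Qed.

Lemma qclosed_formula_in n phi : qclosed [:: n] phi -> formula_in n (formula_of phi).
Proof. by move=> cp m /(qclosed_free cp); rewrite inE => /eqP. Qed.

(** The support of a formula collects the ordinals that a structure has to contain
    in order to interpret its symbols as intended; a relation symbol contributes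
    the field of the relation it codes. *)
Section Support.
Variable field : I -> set I.

Definition rsupp (r : relname I) : set I := if r is RC i then field i else set0.

Fixpoint tsupp (t : term LL) : set I :=
  match t with
  | Var _ => set0
  | App f ts => fun a => f = Some a \/ exists i, tsupp (ts i) a
  end.

Fixpoint fsupp (phi : formula LL) : set I :=
  match phi with
  | Fal => set0
  | Eq t u => tsupp t `|` tsupp u
  | Rel r ts => fun a => rsupp r a \/ exists i, tsupp (ts i) a
  | Imp phi psi => fsupp phi `|` fsupp psi
  | All _ phi => fsupp phi
  end.

Definition qtover (z : set I) (t : qterm) : Prop := if t is QC a then z a else True.

(** A form of the inclusion of the support in z that computes to the list of
    ordinals and fields in question. *)
Fixpoint qover (z : set I) (phi : qf) : Prop :=
  match phi with
  | QR1 r t => rsupp r `<=` z /\ (0 < relarity r -> qtover z t)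
  | QR2 r t u => rsupp r `<=` z /\ (1 < relarity r -> qtover z t /\ qtover z u)
  | QR3 r t u w => rsupp r `<=` z /\
      (2 < relarity r -> [/\ qtover z t, qtover z u & qtover z w])
  | QEq t u => qtover z t /\ qtover z u
  | QFal => True
  | QImp phi psi | QAnd phi psi | QIff phi psi => qover z phi /\ qover z psi
  | QUAll _ phi | QUEx _ phi | QYAll _ phi | QYEx _ phi => qover z phi
  end.

Lemma tsupp_qtover z t : tsupp (term_of t) `<=` z -> qtover z t.
Proof. by case: t => [n|a|n] //=; apply; left. Qed.

Lemma fsupp_qover z phi : fsupp (formula_of phi) `<=` z -> qover z phi.
Proof.
elim: phi => [r t|r t u|r t u w|t u| |phi IH psi IH'|phi IH psi IH'|
  phi IH psi IH'|m phi IH|m phi IH|m phi IH|m phi IH] /= h.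
- split=> [a ra|r0]; first by apply: h; left.
  by apply: tsupp_qtover => a ta; apply: h; right; exists (Ordinal r0).
- split=> [a ra|r1]; first by apply: h; left.
  split; apply: tsupp_qtover => a ta; apply: h; right.
    by exists (Ordinal (ltnW r1)).
  by exists (Ordinal r1).
- split=> [a ra|r2]; first by apply: h; left.
  split; apply: tsupp_qtover => a ta; apply: h; right.
  + by exists (Ordinal (ltnW (ltnW r2))).
  + by exists (Ordinal (ltnW r2)).
  + by exists (Ordinal r2).
- by split; apply: tsupp_qtover => a ta; apply: h; [left|right].
- by [].
- by split; [apply: IH|apply: IH'] => a fa; apply: h; [left|right].
- by split; [apply: IH|apply: IH'] => a fa; apply: h; left; [left|right; left].
- by split; [apply: IH|apply: IH'] => a fa; apply: h; left; left; [left|right].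
- by apply: IH => a fa; apply: h; right.
- by apply: IH => a fa; apply: h; left; left; left; right; left.
- by apply: IH => a fa; apply: h; right.
- by apply: IH => a fa; apply: h; left; left; left; right; left.
Qed.

End Support.
End Fragment.
Arguments const_val : simpl never.
Arguments index_val : simpl never.

(** * The intended models *)

Section IntendedModels.
Context {d : Order.disp_t} {mu : orderType d} {kappa : set mu}.
Variables (Tr : set mu -> set (@pfun2 _ mu)) (La : set (@pfun2 _ mu)).
Variable dec : mu -> set (mu * mu).
Variables e0 e1 w : mu.
Let LL := tree_language mu.

Definition dec_field (i : mu) : set mu := fst @` dec i `|` snd @` dec i.

(** A small relation codes a node by marking its domain with [e0], and the points
    where its value is true with [e1]. *)
Definition node (i : mu) : @pfun2 _ mu :=
  fun b => if `[< dec i (e0, b) >] then Some `[< dec i (e1, b) >] else None.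

(** An approximation has ordinals [ap_z], a partial branch [ap_b], the sets [ap_Y],
    and interpretations of D, G and S. *)
Record approx := Approx {
  ap_z : set mu;
  ap_pt : exists a, ap_z a;
  ap_b : mu -> bool;
  ap_D : set mu;
  ap_G : mu -> mu -> Prop;
  ap_Y : set (set mu);
  ap_S : set mu -> mu -> mu -> Prop }.

(** What makes an approximation useful, where w stands for omega.  The cofinality D of
    kappa restricted to z and the map G are always there.  The sets in Y are
    cofinal and closed only when omega is in D, that is when the ladder system
    provides them, and closed only under unions of length in D. *)
Record adequate (M : approx) : Prop := Adequate {
  adequate_down : forall a b, ap_z M a -> kappa a -> (b < a)%O -> ap_z M b;
  adequate_card : cardinal (ap_z M `&` kappa) = ap_z M `&` kappa;
  adequate_tree : forall x, Psub kappa [set: mu] x -> x `<=` ap_z M ->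
    Tr x (brestr (ap_b M) x);
  adequate_Dsub : ap_D M `<=` ap_z M `&` kappa;
  adequate_Ddown : forall a b, ap_D M a -> (b < a)%O -> ap_D M b;
  adequate_Gfun : forall a t t', ap_G M a t -> ap_G M a t' -> t = t';
  adequate_Gcof : forall u, (ap_z M `&` kappa) u -> exists a t,
    [/\ ap_D M a, ap_G M a t, (ap_z M `&` kappa) t & (u <= t)%O];
  adequate_Ysub : ap_Y M `<=` Psub (ap_z M `&` kappa) (ap_z M);
  adequate_YL : forall y, ap_Y M y -> La (brestr (ap_b M) y);
  adequate_Ycof : ap_D M w -> forall x, Psub (ap_z M `&` kappa) (ap_z M) x ->
    exists2 y, ap_Y M y & x `<=` y;
  adequate_Ycl : ap_D M w -> forall l (s : mu -> set mu), ap_D M l -> seg l !=set0 ->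
    (forall a, seg l a -> ap_Y M (s a)) ->
    (forall a b, seg l b -> (a <= b)%O -> s a `<=` s b) ->
    ap_Y M (\bigcup_(a in seg l) s a);
  adequate_Ssurj : forall y, ap_Y M y -> exists2 l, (ap_z M `&` kappa) l &
    forall a, y a -> exists2 i, (i < l)%O & ap_S M y i a;
  adequate_Sfun : forall y i a a', ap_S M y i a -> ap_S M y i a' -> a = a' }.

Section Model.
Variable M : approx.

(** Each set appears once with every possible index, so that the type below can
    compare it with every coded node. *)
Definition ap_carrier : Type :=
  ({a | ap_z M a} + {q : set mu * mu | ap_Y M q.1 /\ ap_z M q.2})%type.

Definition named a (za : ap_z M a) : ap_carrier := inl (exist _ a za).

Definition ap_const (a : mu) : ap_carrier :=
  if pselect (ap_z M a) is left za then named za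
  else named (svalP (cid (ap_pt M))).

Definition onU (x : ap_carrier) (P : mu -> Prop) : Prop :=
  if x is inl a then P (sval a) else False.

Definition onY (x : ap_carrier) (P : set mu -> Prop) : Prop :=
  if x is inr q then P (sval q).1 else False.

Definition ap_index (x : ap_carrier) : ap_carrier :=
  match x with inl _ => x | inr q => named (svalP q).2 end.

Definition ap_rel (r : relname mu) : ('I_(relarity r) -> ap_carrier) -> Prop :=
  match r with
  | RY => fun g => onY (g ord0) (fun=> True)
  | RB => fun g => onU (g ord0) (fun a => ap_b M a)
  | RK => fun g => onU (g ord0) kappa
  | RD => fun g => onU (g ord0) (ap_D M)
  | RLt => fun g => onU (g ord0) (fun a => onU (g ord_max) (fun b => (a < b)%O))
  | RG => fun g => onU (g ord0) (fun a => onU (g ord_max) (ap_G M a))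
  | RE => fun g => onU (g ord0) (fun a => onY (g ord_max) (fun y => y a))
  | RS => fun g => onY (g ord0) (fun y =>
      onU (g (Ordinal (isT : 1 < 3))) (fun i => onU (g ord_max) (ap_S M y i)))
  | RC i => fun g => onU (g ord0) (fun a => onU (g ord_max) (fun b => dec i (a, b)))
  end.

Definition ap_fun (f : option mu) :
    ('I_(if f is Some _ then 0 else 1) -> ap_carrier) -> ap_carrier :=
  match f with Some a => fun=> ap_const a | None => fun g => ap_index (g ord0) end.

Definition ap_model : structure LL := {|
  carrier := ap_carrier;
  carrier_inhabited := inhabits (named (svalP (cid (ap_pt M))));
  finterp := ap_fun : forall f : Defs.fsym LL, ('I_(far f) -> ap_carrier) -> ap_carrier;
  rinterp := ap_rel : forall r : Defs.rsym LL, ('I_(rar r) -> ap_carrier) -> Prop |}.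

Lemma ap_constE a (za : ap_z M a) : const_val ap_model a = named za.
Proof.
rewrite /const_val /= /ap_const; case: pselect => // za'.
by congr named; exact: Prop_irrelevance.
Qed.

Lemma ap_indexE (q : {q : set mu * mu | ap_Y M q.1 /\ ap_z M q.2}) :
  index_val (N := ap_model) (inr q) = const_val ap_model (sval q).2.
Proof. by rewrite (ap_constE (svalP q).2). Qed.

End Model.

(** Not a list of axioms, but all that the adequate approximations agree on once
    they contain the support; see [transfer] for the use of it. *)
Definition intended_theory : set (formula LL) := [set phi | sentence phi /\
  forall M, adequate M -> fsupp dec_field phi `<=` ap_z M ->
  forall v, sat (A := ap_model M) v phi].

(** The variable 0 denotes a set which, at the ordinal b, looks like the domain of
    the node i, with the branch having the value of the node. *)
Definition agrees (i b : mu) : qf mu :=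
  QAnd (QR1 RY (QV _ 0)) (QAnd
    (QIff (QR2 RE (QC b) (QV _ 0)) (QR2 (RC i) (QC e0) (QC b)))
    (QImp (QR2 (RC i) (QC e0) (QC b))
          (QIff (QR1 RB (QC b)) (QR2 (RC i) (QC e1) (QC b))))).

(** The instance at b of the assertion that variable 0, if its index is i, denotes
    a set on which the branch is the node i, and that this node is outside La.  All
    instances hold for an element without a named index, so omitting the type
    also ensures that every ordinal is named. *)
Definition bad_at (i b : mu) : qf mu :=
  QImp (QEq (QX _ 0) (QC i)) (QAnd (agrees i b)
    (if `[< La (node i) >] then QFal _ else QImp (QFal _) (QFal _))).

Definition bad_node_type : set (formula LL) :=
  [set phi | exists i b, phi = formula_of (bad_at i b)].

Lemma bad_node_type_formula : bad_node_type `<=` @formula_in LL 0.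
Proof.
move=> _ [i [b ->]]; apply: qclosed_formula_in.
by rewrite /bad_at; case: ifP.
Qed.

(** Indices are named, and a set y of the approximation is contained in z: if y
    and the branch agreed with the node i at all points of z, they would agree
    everywhere, as the domain of this node is contained in z too. *)
Lemma ap_model_omits M (Z : set (formula LL)) : adequate M ->
  ap_z M e0 -> ap_z M e1 ->
  (forall i, ap_z M i -> dec_field i `<=` ap_z M) ->
  (forall i b, ap_z M i -> ap_z M b -> Z (formula_of (bad_at i b))) ->
  omits (ap_model M) 0 (Z `&` bad_node_type).
Proof.
move=> gM z0 z1 zf Zm x rx.
have {Zm rx} sx i b : ap_z M i -> ap_z M b ->
    qsat (N := ap_model M) (fun=> x) (bad_at i b).
  move=> zi zb; rewrite -sat_formula_of; apply: rx => //.
  by split; [exact: Zm|exists i, b].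
case: x sx => [[i zi]|[[y i] [/= Yy zi]]] sx.
  by have := sx i i zi zi; rewrite /bad_at /= => /(_ (esym (ap_constE zi)))[[]].
have {sx} [nL sx] : ~ La (node i) /\ forall b, ap_z M b ->
    (y b <-> dec i (e0, b)) /\ (dec i (e0, b) -> (ap_b M b <-> dec i (e1, b))).
  have {}sx b : ap_z M b -> _ := fun zb => sx i b zi zb (ap_indexE _).
  split; first by case: (sx i zi) => _; case: asboolP.
  move=> b zb; have [[_]] := sx b zb.
  by rewrite /= /rel2 /rel1 /= /args2 /= (ap_constE zb) (ap_constE z0) (ap_constE z1).
apply: nL; suff -> : node i = brestr (ap_b M) y by exact: adequate_YL gM _ Yy.
have [yz _] := adequate_Ysub gM Yy.
apply/funext => b; rewrite /node /brestr /restr; case: (asboolP (y b)) => yb.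
  have [yd db] := sx b (yz b yb); have d0 := yd.1 yb.
  rewrite asboolT //; congr Some; have [h h'] := db d0.
  by apply/asboolP/idP.
rewrite asboolF // => d0; apply: yb.
have zb : ap_z M b by apply: (zf i zi); right; exists (e0, b).
exact: (sx b zb).1.2.
Qed.

(** * Models of the intended theory *)

Section FinalModel.
Variable A : structure LL.
Hypothesis A_models : models A intended_theory.
Hypothesis A_omits : omits A 0 bad_node_type.

(** Each property of the final model is obtained by writing it as a formula,
    checking it in the approximations, and reading it back. *)
Lemma transfer phi : qclosed [::] phi ->
  (forall M, adequate M -> qover dec_field (ap_z M) phi ->
     forall v, qsat (N := ap_model M) v phi) ->
  forall v, qsat (N := A) v phi.
Proof.
move=> cl phiM v; rewrite -sat_formula_of; apply: A_models.
split; first exact: qclosed_sentence.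
by move=> M gM zphi v'; rewrite sat_formula_of; apply: phiM => //; exact: fsupp_qover.
Qed.

Local Notation Y := (rel1 (N := A) RY).
Local Notation B a := (rel1 (N := A) RB (const_val A a)).
Local Notation K := (rel1 (N := A) RK).
Local Notation D a := (rel1 (N := A) RD (const_val A a)).
Local Notation Lt := (rel2 (N := A) RLt).
Local Notation E a y := (rel2 (N := A) RE (const_val A a) y).
Local Notation C i := (rel2 (N := A) (RC i)).
Let v0 : nat -> carrier A := fun=> const_val A e0.

Lemma const_notY a : ~ Y (const_val A a).
Proof.
apply: (transfer (phi := QNot (QR1 RY (QC a)))) v0 => // M gM [[_ /(_ isT) za] _] v /=.
by rewrite /rel1 /= (ap_constE za).
Qed.

Lemma const_inj a b : const_val A a = const_val A b -> a = b.
Proof.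
move=> e; apply: contrapT => ab; move: e.
apply: (transfer (phi := QNot (QEq (QC a) (QC b)))) v0 => // M gM [[za zb] _] v /=.
by rewrite (ap_constE za) (ap_constE zb) => -[].
Qed.

Lemma lit_transfer (P : Prop) phi : qclosed [::] phi ->
  (forall M, adequate M -> qover dec_field (ap_z M) phi ->
     forall v, qsat (N := ap_model M) v phi <-> P) ->
  qsat (N := A) v0 phi <-> P.
Proof.
move=> cl phiM; have [p|np] := pselect P.
  by split=> // _; apply: transfer v0 => // M gM zM v; apply/phiM.
split=> // s; suff : qsat (N := A) v0 (QNot phi) by move=> /(_ s).
apply: transfer v0 => [|M gM [zM _] v /=]; first by rewrite /= cl.
by move=> /(phiM M gM zM).
Qed.

Lemma constLt a b : Lt (const_val A a) (const_val A b) <-> (a < b)%O.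
Proof.
apply: (lit_transfer (phi := QR2 RLt (QC a) (QC b))) => // M gM [_ /(_ isT)[za zb]] v.
by rewrite /= /rel2 /= /args2 /= (ap_constE za) (ap_constE zb).
Qed.

Lemma constK a : K (const_val A a) <-> kappa a.
Proof.
apply: (lit_transfer (phi := QR1 RK (QC a))) => // M gM [_ /(_ isT) za] v.
by rewrite /= /rel1 /= (ap_constE za).
Qed.

Lemma constC i a b : C i (const_val A a) (const_val A b) <-> dec i (a, b).
Proof.
apply: (lit_transfer (phi := QR2 (RC i) (QC a) (QC b))) => // M gM [_ /(_ isT)[za zb]] v.
by rewrite /= /rel2 /= /args2 /= (ap_constE za) (ap_constE zb).
Qed.

(** As the free variable is the only one, the assignment may be taken constant. *)
Lemma omitted x : exists i b, index_val x = const_val A i /\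
  ~ qsat (fun=> x) (QAnd (agrees i b)
    (if `[< La (node i) >] then QFal _ else QImp (QFal _) (QFal _))).
Proof.
have := A_omits (a := x) => /existsNP[phi /not_implyP[[i [b ->]]]].
move=> /existsNP[v /not_implyP[vx ns]].
exists i, b.
have : ~ sat (fun=> x) (formula_of (bad_at i b)).
  move=> s; apply: ns; apply/(sat_ext (w := fun=> x)) => // n.
  by move=> /(bad_node_type_formula (ex_intro _ i (ex_intro _ b erefl)))->.
by rewrite sat_formula_of /= => /not_implyP.
Qed.

Lemma namedU x : ~ Y x -> exists a, x = const_val A a.
Proof.
move=> nYx; have [i [b [xi _]]] := omitted x; exists i; rewrite -xi.
have := transfer (phi := QUAll 0 (QEq (QX _ 0) (QV _ 0))) => /(_ isT) h.
have /(_ v0 x nYx) : forall v, qsat (N := A) v (QUAll 0 (QEq (QX _ 0) (QV _ 0))).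
  by apply: h => M gM _ v [a _|q []].
by rewrite /= /upd /= => ->.
Qed.

Definition members (y : carrier A) : set mu := [set a | E a y].

Lemma index_transfer i y : Y y ->
  exists y', [/\ Y y', index_val y' = const_val A i & forall a, E a y <-> E a y'].
Proof.
pose phi := QYAll 0 (QYEx 1 (QAnd (QEq (QX _ 1) (QC i))
  (QUAll 2 (QIff (QR2 RE (QV _ 2) (QV _ 0)) (QR2 RE (QV _ 2) (QV _ 1)))))).
have : qsat (N := A) v0 phi.
  apply: transfer => // M gM [[_ zi] _] v /= [a []|[[x j] [/= Yx zj]] _].
  rewrite /upd /=; exists (inr (exist _ (x, i) (conj Yx zi))); split=> //; split.
    by rewrite ap_indexE.
  by case=> [a _|q []].
rewrite /= /upd /= => h Yy; have [y' [Yy' [e ee]]] := h y Yy.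
by exists y'; split=> // a; exact: (ee _ (@const_notY a)).
Qed.

(** In an approximation the branch restricted to x is a node of [Tr x], hence some
    [f j] with j below l; here i codes x, and t codes the family of the f j. *)
Lemma branch_transfer i t l x (f : mu -> @pfun2 _ mu) :
  Psub kappa [set: mu] x -> kappa l ->
  (forall eta, Tr x eta -> exists2 j, (j < l)%O & f j = eta) ->
  (forall j, Tr x (f j) -> dom (f j) = x) ->
  (forall a, dec i (e0, a) <-> x a) ->
  (forall j a, dec t (j, a) <-> [/\ (j < l)%O, x a & f j a = Some true]) ->
  exists2 j, (j < l)%O & forall a, x a -> (B a <-> f j a = Some true).
Proof.
move=> xs kl fs fd iE tE.
pose phi := QUEx 0 (QAnd (QR2 RLt (QV _ 0) (QC l)) (QUAll 1 (QImp
  (QR2 (RC i) (QC e0) (QV _ 1)) (QIff (QR1 RB (QV _ 1)) (QR2 (RC t) (QV _ 0) (QV _ 1)))))).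
have : qsat (N := A) v0 phi.
  apply: transfer => // M gM /= [[_ /(_ isT)[_ zl]] [[zi /(_ isT)[ze0 _]] _]] v.
  have xz : x `<=` ap_z M by move=> a xa; apply: zi; right; exists (e0, a) => //; apply/iE.
  have Tb := adequate_tree gM xs xz.
  have [j jl fj] := fs _ Tb.
  have zj : ap_z M j := adequate_down gM zl kl jl.
  exists (named zj); split; first by case.
  rewrite /upd /= /rel2 /rel1 /= /args2 /=.
  rewrite (ap_constE zl) (ap_constE ze0); split=> //.
  case=> [[a za] _|q []] //= /iE xa; rewrite tE fj brestrE //.
  by split=> [->|[_ _ [->]]].
rewrite /= /upd /= => -[y [nYy]]; have [j ->] := namedU nYy.
move=> [/constLt jl h]; exists j => // a xa.
have := h (const_val A a) (@const_notY a); rewrite constC iE => /(_ xa) ->.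
by rewrite constC tE; split=> [[]|].
Qed.

Lemma D_down a b : D a -> (b < a)%O -> D b.
Proof.
pose phi := QUAll 0 (QUAll 1 (QImp (QR1 RD (QV mu 0)) (QImp
  (QR2 RLt (QV _ 1) (QV _ 0)) (QR1 RD (QV _ 1))))).
have : qsat (N := A) v0 phi.
  apply: transfer => // M gM _ v /= [a0 _|q []] // [b0 _|q []] //.
  by rewrite /rel2 /rel1 /= /args2 /=; exact: adequate_Ddown.
rewrite /= /upd /= => h Da ba.
exact: (h _ (@const_notY a) _ (@const_notY b) Da ((constLt b a).2 ba)).
Qed.

Lemma G_cofinal : exists G : mu -> mu -> Prop,
  (forall a t t', D a -> G a t -> G a t' -> t = t') /\
  forall u, kappa u -> exists a t, [/\ D a, G a t, kappa t & (u <= t)%O].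
Proof.
exists (fun a t => rel2 RG (const_val A a) (const_val A t)); split.
  pose phi := QUAll 0 (QUAll 1 (QUAll 2 (QImp (QR2 RG (QV mu 0) (QV _ 1)) (QImp
    (QR2 RG (QV _ 0) (QV _ 2)) (QEq (QV _ 1) (QV _ 2)))))).
  have : qsat (N := A) v0 phi.
    apply: transfer => // M gM _ v /= [a0 _|q []] // [b0 _|q []] // [c0 _|q []] //.
    rewrite /upd /= /rel2 /= /args2 /=.
    case: b0 c0 => b zb [c zc] /= Gb Gc.
    by congr inl; apply: eq_exist; exact: adequate_Gfun Gb Gc.
  rewrite /= /upd /= => h a t t' _ Gt Gt'; apply: const_inj.
  exact: (h _ (@const_notY a) _ (@const_notY t) _ (@const_notY t')).
pose phi := QUAll 0 (QImp (QR1 RK (QV mu 0)) (QUEx 1 (QUEx 2 (QAnd (QR1 RD (QV _ 1))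
  (QAnd (QR2 RG (QV _ 1) (QV _ 2)) (QAnd (QR1 RK (QV _ 2))
    (QNot (QR2 RLt (QV _ 2) (QV _ 0))))))))).
have : qsat (N := A) v0 phi.
  apply: transfer => // M gM _ v /= [[u zu] _|q []] //.
  rewrite /upd /= /rel2 /rel1 /= /args2 /= => ku.
  have [a [t [Da Gt [zt kt] ut]]] := adequate_Gcof gM (conj zu ku).
  have [za _] := adequate_Dsub gM Da.
  exists (named za); split=> //; exists (named zt); split=> //; split=> //; split=> //.
  by split=> //=; rewrite ltNge ut.
rewrite /= /upd /= => h u ku.
have [a' [/namedU[a ->] [t' [/namedU[t ->] [Da [Gt [/constK kt nlt]]]]]]] :=
  h _ (@const_notY u) ((constK u).2 ku).
exists a, t; split=> //; rewrite leNgt; apply/negP => tu; apply: nlt.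
exact/constLt.
Qed.

(** The mark [e1] on l puts the size l of x in the support, so that x is also small
    in the sense of the approximation. *)
Lemma Y_cofinal i l x : D w -> kappa l -> x #= seg l ->
  (forall a, dec i (e0, a) <-> x a) -> dec i (e1, l) ->
  exists2 y, Y y & x `<=` members y.
Proof.
move=> Dw kl xl iE il.
pose phi := QImp (QR1 RD (QC w)) (QYEx 0 (QUAll 1 (QImp (QR2 (RC i) (QC e0) (QV _ 1))
  (QR2 RE (QV _ 1) (QV _ 0))))).
have : qsat (N := A) v0 phi.
  apply: transfer => // M gM /= [[_ /(_ isT) zw] [[zi /(_ isT)[ze0 _]] _]] v.
  rewrite /rel1 /= (ap_constE zw) /= => Dw'.
  have xz : x `<=` ap_z M by move=> a xa; apply: zi; right; exists (e0, a) => //; apply/iE.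
  have zl : ap_z M l by apply: zi; right; exists (e1, l).
  have [|y Yy xy] := adequate_Ycof gM Dw' (x := x).
    split=> //; apply: card_le_lt_trans (card_eq_leW xl) _.
    exact: cardinal_seg_lt (adequate_card gM) (conj zl kl).
  exists (inr (exist _ (y, w) (conj Yy zw))); split=> // -[[a za] _|q []] //.
  rewrite /upd /= /rel2 /= /args2 /= (ap_constE ze0) /= => /iE; exact: xy.
rewrite /= /upd /= => h; have [y [Yy ye]] := h Dw.
exists y => // a xa; apply: (ye _ (@const_notY a)).
by apply/constC/iE.
Qed.

Lemma members_small y : Y y -> exists2 l, kappa l & members y #<= seg l.
Proof.
pose phi := QYAll 0 (QUEx 1 (QAnd (QR1 RK (QV mu 1)) (QUAll 2 (QImp
  (QR2 RE (QV _ 2) (QV _ 0)) (QUEx 3 (QAnd (QR2 RLt (QV _ 3) (QV _ 1))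
   (QR3 RS (QV _ 0) (QV _ 3) (QV _ 2)))))))).
have h : qsat (N := A) v0 phi.
  apply: transfer => // M gM _ v /= [a []|[[x j] [/= Yx zj]] _].
  have [l [zl kl] lS] := adequate_Ssurj gM Yx.
  exists (named zl); split=> //; split=> // -[[a za] _|q []] //.
  rewrite /upd /= /rel2 /rel3 /= /args2 /args3 /= => /lS[i il Si].
  by exists (named (adequate_down gM zl kl il)); split; [case|split].
pose phi' := QYAll 0 (QUAll 1 (QUAll 2 (QUAll 3 (QImp (QR3 RS (QV mu 0) (QV _ 1) (QV _ 2))
  (QImp (QR3 RS (QV _ 0) (QV _ 1) (QV _ 3)) (QEq (QV _ 2) (QV _ 3))))))).
have h' : qsat (N := A) v0 phi'.
  apply: transfer => // M gM _ v /= [a []|q _] // [i _|? []] // [a _|? []] // [b _|? []] //.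
  rewrite /upd /= /rel3 /= /args3 /=; case: a b => a za [b zb] /= Sa Sb.
  by congr inl; apply: eq_exist; exact: adequate_Sfun Sa Sb.
move: h h'; rewrite /= /upd /= => h h' Yy.
have [l' [/namedU[l ->] [/constK kl lS]]] := h y Yy.
have /choice[f fP] : forall i, exists a, forall a',
    rel3 RS y (const_val A i) (const_val A a') -> a' = a.
  move=> i.
  case: (pselect (exists a, rel3 RS y (const_val A i) (const_val A a))) => [[a Sa]|na].
    exists a => a' Sa'; apply: const_inj.
    exact: (h' y Yy _ (@const_notY i) _ (@const_notY a') _ (@const_notY a)).
  by exists i => a' Sa'; case: na; exists a'.
exists l => //; apply: (@card_le_of_surj _ _ _ _ f) => a Ea.
have [i' [/namedU[i ->] [/constLt il Sa]]] := lS _ (@const_notY a) Ea.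
by exists i => //; rewrite (fP i a Sa).
Qed.

(** The relation t codes the sequence s; its length is in D, so the approximation
    contains the union. *)
Lemma Y_closed t l (s : mu -> set mu) : D w -> D l -> seg l !=set0 ->
  (forall a, seg l a -> exists2 y, Y y & s a = members y) ->
  (forall a b, seg l b -> (a <= b)%O -> s a `<=` s b) ->
  (forall a u, dec t (a, u) <-> (a < l)%O /\ s a u) ->
  exists2 y, Y y & \bigcup_(a in seg l) s a = members y.
Proof.
move=> Dw Dl l0 sY smono tE.
pose phi := QImp (QR1 RD (QC w)) (QImp (QR1 RD (QC l)) (QImp
  (QUAll 0 (QImp (QR2 RLt (QV _ 0) (QC l)) (QYEx 1 (QUAll 2
     (QIff (QR2 RE (QV _ 2) (QV _ 1)) (QR2 (RC t) (QV _ 0) (QV _ 2)))))))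
  (QYEx 0 (QUAll 1 (QIff (QR2 RE (QV _ 1) (QV _ 0)) (QUEx 2 (QAnd
     (QR2 RLt (QV _ 2) (QC l)) (QR2 (RC t) (QV _ 2) (QV _ 1))))))))).
have : qsat (N := A) v0 phi.
  apply: transfer => // M gM /= [[_ /(_ isT) zw] [[_ /(_ isT) zl] [[_ [_ [zt _]]] _]]] v.
  rewrite /rel1 /= (ap_constE zw) (ap_constE zl) /= => Dw' Dl' sM.
  have kl : kappa l by have [] := adequate_Dsub gM Dl'.
  have zs a : seg l a -> s a `<=` ap_z M.
    by move=> la u su; apply: zt; right; exists (a, u) => //; apply/tE.
  have Ys a : seg l a -> ap_Y M (s a).
    move=> la; have za := adequate_down gM zl kl la.
    have := sM (named za) id; rewrite /upd /= /rel2 /= /args2 /= => /(_ la).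
    case=> x [Yx]; case: x Yx => [u []|[[y j] [/= Yy zj]] _ ye].
    suff -> : s a = y by [].
    apply/seteqP; split=> u ua.
      by have /= -> := ye (named (zs a la u ua)) id; apply/tE.
    have [yz _] := adequate_Ysub gM Yy.
    by have /= [/(_ ua) /tE[]] := ye (named (yz u ua)) id.
  have YU := adequate_Ycl gM Dw' Dl' l0 Ys smono.
  exists (inr (exist _ (\bigcup_(a in seg l) s a, w) (conj YU zw))); split=> //.
  case=> [[u zu] _|q []] //; rewrite /upd /= /rel2 /= /args2 /=; split.
    move=> [a la sa]; exists (named (adequate_down gM zl kl la)); split=> //.
    by split=> //; apply/tE.
  by move=> [[[a za]|q] [_ []]] //= la /tE[_ sa]; exists a.
rewrite /= /upd /= => h; have [|y [Yy ye]] := h Dw Dl.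
  move=> i' /namedU[a ->] /constLt la; have [y Yy sy] := sY a la.
  exists y; split=> // u' /namedU[u ->]; rewrite (constC t a u).
  split; first by move=> Eu; apply/tE; split=> //; rewrite sy.
  by move=> /tE[_]; rewrite sy.
exists y => //; apply/seteqP; split=> u.
  move=> [a la sa]; apply/(ye _ (@const_notY u)); exists (const_val A a).
  by split; [exact: const_notY|split; [exact/constLt|apply/constC/tE]].
move=> /(ye _ (@const_notY u))[a' [/namedU[a ->] [/constLt la /constC/tE[_ su]]]].
by exists a.
Qed.

(** By [index_transfer] the set reappears with the code i as its index, and the
    omission of the type at this copy says that the node i is in La. *)
Lemma members_La i y : Y y ->
  node i = brestr (fun a => `[< B a >]) (members y) ->
  La (brestr (fun a => `[< B a >]) (members y)).
Proof.
move=> Yy iE; rewrite -iE; apply: contrapT => nLa.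
have [y' [Yy' y'i ye]] := index_transfer i Yy.
have [i' [b [y'i' []]]] := omitted y'.
have {i' y'i'} -> : i' = i by apply: const_inj; rewrite -y'i -y'i'.
rewrite /= asboolF //=; split=> //; split=> //.
have iEb := congr1 (@^~ b) iE; rewrite /node /brestr /restr in iEb.
rewrite (propext (constC i e0 b)) (propext (constC i e1 b)) -(propext (ye b)).
move: iEb; case: (asboolP (dec i (e0, b))) => d0.
  case: (asboolP (members y b)) => // yb [e]; split=> // _.
  by split=> [/asboolT|/asboolT]; [rewrite -e|rewrite e] => /asboolP.
by case: (asboolP (members y b)) => // yb _; split=> //; split.
Qed.

End FinalModel.
End IntendedModels.

(** * From compactness to ladder systems *)

Section CompactnessToLadder.
Context {d : Order.disp_t} {mu : orderType d} {kappa : set mu}.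
Hypothesis mu_wo : well_order (fun a b : mu => (a <= b)%O).
Hypothesis mu_card : is_cardinal [set: mu].
Hypothesis kappa_inacc : inaccessible kappa.
Hypothesis mu_pow : [set: short_seqs kappa] #= [set: mu].

(** If m is the least element outside [cof rho], some unbounded set has at most
    the cardinality of [seg m], and [seg m] is contained in [cof rho]. *)
Lemma cof_attained (rho : set mu) : exists2 C, unbounded rho C & cof rho #= C.
Proof.
have [C uC cC] : exists2 C, unbounded rho C & cardinal C `<=` cof rho.
  have urho : unbounded rho rho by split=> // a ra; exists a.
  have [[a na]|all] := pselect (exists a, ~ cof rho a); last first.
    by exists rho => // a _; apply: contrapT => na; apply: all; exists a.
  have [|m nm mmin] := @wo_min _ _ mu_wo (~` cof rho); first by exists a.
  have /existsNP[C /not_implyP[uC nC]] := nm.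
  exists C => // b Cb; apply: contrapT => /mmin mb; apply: nC.
  apply: card_le_lt_trans Cb; exact: subset_card_le (seg_sub mb).
exists C => //; suff -> : cof rho = cardinal C.
  exact: (card_cardinal mu_wo mu_card (card_leT C)).
by apply/seteqP; split=> // a; apply.
Qed.

(** Powers of elements of kappa are below kappa, and Cantor's theorem applies. *)
Lemma limit_step a : kappa a -> exists2 b, kappa b & seg a #< seg b.
Proof.
move=> ka; have sp := small_powerset mu_wo kappa_inacc (small_seg kappa_inacc ka).
have [b kb pb] := card_lt_seg mu_wo (kappa_cardinal kappa_inacc) sp.
exists b => //; apply: card_lt_le_trans (card_eq_leW pb); apply: card_ltP.
  apply: (@card_le_of_inj _ _ _ _ (fun x => [set x])) => [x ax _ ->//|x y _ _ e].
  by have : [set x] x by []; rewrite e.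
move=> /(card_le_ex_surj (set0 : set mu))[f fP].
have [|x ax fx] := fP [set x | seg a x /\ ~ f x x]; first by move=> x [].
have nfx : ~ f x x by move=> h; have := h; rewrite {1}fx => -[].
by apply: (nfx); rewrite fx.
Qed.

Section LadderSystem.
Variables (Tr : set mu -> set (@pfun2 _ mu)) (La : set (@pfun2 _ mu)).
Hypothesis Tr_tree : is_tree kappa Tr.
Hypothesis La_ladder : ladder_system kappa Tr La.
Variables (dec : mu -> set (mu * mu)) (e0 e1 w : mu).
Hypothesis dec_small : forall i, dec i #< kappa.
Hypothesis dec_surj : forall r : set (mu * mu), r #< kappa -> exists i, dec i = r.
Hypothesis e01 : e0 <> e1.
(* w stands for omega *)
Hypotheses (w_inf : infinite_set (seg w)) (w_count : countable (seg w)).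
Hypothesis kappa_w : kappa w.

(** The sets of the approximation are the club given by the ladder system when the
    cofinality is uncountable, and none otherwise. *)
Lemma adequate_ex z eta (z0 : exists a, z a) : Psub kappa [set: mu] z ->
  (forall a b, z a -> kappa a -> (b < a)%O -> z b) ->
  cardinal (z `&` kappa) = z `&` kappa -> (La `&` Tr z) eta ->
  exists2 M, adequate (kappa := kappa) Tr La w M & ap_z M = z.
Proof.
move=> zs zdown rhoE [Leta Teta]; set rho := z `&` kappa in rhoE *.
have [Tdom Trestr _] := Tr_tree; have [_ _ Lclub] := La_ladder.
have deta : dom eta = z by exact: (Tdom z zs).1.
pose b a := eta a == Some true.
have bE y : y `<=` z -> brestr b y = restr eta y.
  move=> yz; apply/funext => a; rewrite /brestr /restr; case: asboolP => // /yz.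
  by rewrite -deta /dom /= /b; case: (eta a) => [[]|].
have [C [Crho Cunb] cofC] := cof_attained rho.
have [a0 _] := mu_inh kappa_inacc.
have [f fs] := card_le_ex_surj a0 (card_eq_leW (etrans (card_eq_sym _ _) cofC)).
have [Ys [Ysub YL Ycof Ycl]] : exists Y : set (set mu), [/\ Y `<=` Psub rho z,
    forall y, Y y -> La (restr eta y),
    cof rho w -> forall x, Psub rho z x -> exists2 y, Y y & x `<=` y &
    cof rho w -> forall l (s : mu -> set mu), cof rho l -> seg l !=set0 ->
      (forall a, seg l a -> Y (s a)) ->
      (forall a b, seg l b -> (a <= b)%O -> s a `<=` s b) ->
      Y (\bigcup_(a in seg l) s a)].
  case: (pselect (cof rho w)) => [cw|ncw]; last by exists set0.
  have [||E [Esub Ecof Ecl] EL] := Lclub z eta zs => //.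
    rewrite rhoE; apply/negP => cc.
    have /card_lt_geF := cw C (conj Crho Cunb); apply.
    apply: card_le_trans (card_eq_leW (etrans (card_eq_sym _ _) cofC)) _.
    by apply: card_le_trans cc _; apply/infiniteP.
  rewrite rhoE in Esub Ecof Ecl; exists E; split=> //.
  by move=> y Ey; apply: EL; exists y.
have /choice[S SP] : forall y, exists g : mu -> mu, Ys y ->
    exists2 l, rho l & forall a, y a -> exists2 i, (i < l)%O & g i = a.
  move=> y; case: (pselect (Ys y)) => [/Ysub[_ yr]|]; last by exists id.
  have [l rl yl] := card_lt_seg mu_wo rhoE yr.
  have [g gP] := card_le_ex_surj a0 (card_eq_leW yl).
  by exists g => _; exists l.
exists (Approx z0 b (cof rho) (fun a t => t = f a) Ys (fun y i a => S y i = a)) => //.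
split=> //=.
- by move=> x xs xz; rewrite bE //; exact: Trestr Teta.
- exact: cof_sub rhoE.
- by move=> a c ca /ltW; exact: cof_down ca.
- by move=> a t t' -> ->.
- move=> u ru; have [t Ct ut] := Cunb u ru; have [a ca ta] := fs t Ct.
  by exists a, t; split=> //; exact: Crho.
- by move=> y Yy; rewrite bE; [exact: YL|have [] := Ysub y Yy].
- by move=> y i a a' -> ->.
Qed.

Let LL := tree_language mu.
Let fld := dec_field dec.
Let supp := @fsupp mu fld.

Lemma fld_small i : fld i #< kappa.
Proof. by apply: (small_setU mu_wo kappa_inacc); exact: small_image. Qed.

Lemma tsupp_small (t : term LL) : @tsupp mu t #< kappa.
Proof.
elim: t => [n|f ts IH] /=; first exact: (small_finite kappa_inacc).
rewrite (_ : (fun a => _) = [set a | f = Some a] `|`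
  \bigcup_(i in [set: 'I_(far f)]) tsupp (ts i)).
  apply: (small_setU mu_wo kappa_inacc).
    by apply: (small_subsingleton kappa_inacc) => x y /= -> [].
  apply: (small_bigcup mu_wo kappa_inacc) => [|i _]; last exact: IH.
  by apply: (small_finite kappa_inacc); exact: finite_finset.
by apply/seteqP; split=> a [|[i]]; [left|right; exists i|left|right; exists i].
Qed.

Lemma supp_small phi : supp phi #< kappa.
Proof.
elim: phi => [|t u|r ts|phi IH psi IH'|n phi IH] //=.
- exact: (small_finite kappa_inacc).
- by apply: (small_setU mu_wo kappa_inacc); exact: tsupp_small.
- rewrite (_ : (fun a => _) = rsupp fld r `|` \bigcup_(i in [set: 'I_(rar r)]) tsupp (ts i)).
    apply: (small_setU mu_wo kappa_inacc).
      case: r {ts} => [||||||||i] /=; try exact: (small_finite kappa_inacc).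
      exact: fld_small.
    apply: (small_bigcup mu_wo kappa_inacc) => [|i _]; last exact: tsupp_small.
    by apply: (small_finite kappa_inacc); exact: finite_finset.
  by apply/seteqP; split=> a [|[i]]; [left|right; exists i|left|right; exists i].
- exact: (small_setU mu_wo kappa_inacc).
Qed.

Let wt := bad_node_type La dec e0 e1.
Let th := intended_theory (kappa := kappa) Tr La dec w.
Let ms i b := formula_of (bad_at La dec e0 e1 i b).

Lemma ms_supp i b : [/\ supp (ms i b) i, supp (ms i b) b, supp (ms i b) e0,
  supp (ms i b) e1 & fld i `<=` supp (ms i b)].
Proof.
have : qover fld (supp (ms i b)) (bad_at La dec e0 e1 i b) by exact: fsupp_qover.
rewrite /bad_at /= => -[[_ si] [[_ [[[_ /(_ isT)[sb _]] +] [_ [_ [_ +]]]]] _]].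
move=> [sf /(_ isT)[s0 _]] /(_ isT)[s1 _].
by split.
Qed.

(** The traces z of a club of Z in P_kappa (theory `|` type) are in the club of
    the ladder system, and closed enough for the part of kappa in z to be an
    initial segment of kappa and a limit cardinal.  The closure of z is imposed on
    Z through the instances of the type. *)
Lemma approximations : club_many kappa (th `|` wt) (fun Z =>
  exists A : structure LL, models A (Z `&` th) /\ omits A 0 (Z `&` wt)).
Proof.
have [_ [E clE EL] _] := La_ladder.
have /choice[h hP] : forall a, exists b, kappa a -> kappa b /\ seg a #< seg b.
  by move=> a; case: (pselect (kappa a)) => [/limit_step[b]|]; [exists b|exists a].
(* an element of kappa brings in one of larger cardinality, and all those below *)
pose near a : set mu := if `[< kappa a >] then seg (h a) `|` [set h a] else set0.
have near_small a : near a #< kappa.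
  rewrite /near; case: asboolP => [/hP[kh _]|_]; last exact: (small_finite kappa_inacc).
  apply: (small_setU mu_wo kappa_inacc); first exact: (small_seg kappa_inacc).
  by apply: (small_finite kappa_inacc); exact: finite_set1.
pose R phi psi := \bigcup_(a in supp phi)
  ((ms a @` supp psi) `|` ((fun b => ms b b) @` near a)).
have wt_ms i b : wt (ms i b) by exists i, b.
exists [set Z | [/\ Psub kappa (th `|` wt) Z, Z (ms e0 e0),
    E (\bigcup_(phi in Z) supp phi) & forall phi psi, Z phi -> Z psi -> R phi psi `<=` Z]].
  apply: (club_pullback mu_wo kappa_inacc _ clE) => [|phi _|phi psi _ _|a _].
  - by right.
  - by split=> //; exact: supp_small.
  - split; first by move=> _ [a _ [[b _ <-]|[b _ <-]]]; right.
    apply: (small_bigcup mu_wo kappa_inacc) => [|a _]; first exact: supp_small.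
    apply: (small_setU mu_wo kappa_inacc); apply: small_image => //; exact: supp_small.
  - by exists (ms a a); [right|have [] := ms_supp a a].
move=> Z [[ZX Zs] Z0 EZ ZR]; set z := \bigcup_(phi in Z) supp phi in EZ.
have zZ a b : z a -> z b -> Z (ms a b).
  move=> [phi Zphi sa] [psi Zpsi sb]; apply: (ZR phi psi) => //.
  by exists a => //; left; exists b.
have zms a b : Z (ms a b) -> supp (ms a b) `<=` z by move=> Zab c sc; exists (ms a b).
have [_ _ s0 s1 _] := ms_supp e0 e0.
have z0 : z e0 by apply: zms s0.
have z1 : z e1 by apply: zms s1.
have zf i : z i -> fld i `<=` z.
  move=> zi; have [_ _ _ _ sf] := ms_supp i i.
  by apply: subset_trans sf _; apply: zms; exact: zZ.
have znear a : z a -> near a `<=` z.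
  move=> [phi Zphi sa] b ab; have Zbb : Z (ms b b).
    by apply: (ZR phi phi) => //; exists a => //; right; exists b.
  by have [sb _ _ _ _] := ms_supp b b; exact: zms sb.
have zdown a b : z a -> kappa a -> (b < a)%O -> z b.
  move=> za ka ba; apply: (znear a za); rewrite /near asboolT //; left.
  have [_ ah] := hP a ka; rewrite /seg /= ltNge; apply/negP => hb.
  apply: (card_lt_geF ah); apply: subset_card_le; apply: seg_sub.
  exact: le_trans hb (ltW ba).
have kdown := cardinal_down (kappa_cardinal kappa_inacc).
have zcard : cardinal (z `&` kappa) = z `&` kappa.
  apply/seteqP; split=> a.
    move=> /card_lt_geF na; apply: contrapT => nza; apply: na.
    apply: subset_card_le => c [zc kc]; rewrite /seg /= ltNge; apply/negP => ac.
    apply: nza; split; last exact: kdown kc ac.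
    by move: ac; rewrite le_eqVlt => /orP[/eqP ->//|]; exact: zdown.
  move=> [za ka]; have [kh ah] := hP a ka; apply: card_lt_le_trans ah _.
  apply: subset_card_le => c ch; split; last exact: kdown kh (ltW ch).
  by apply: (znear a za); rewrite /near asboolT //; left.
have [ESub _ _] := clE.
have [eta Leta] := EL z EZ.
have [M gM Mz] := @adequate_ex z eta (ex_intro _ e0 z0) (ESub z EZ) zdown zcard Leta.
exists (ap_model (kappa := kappa) dec M); split.
  move=> phi [Zphi [_ thphi]] v; apply: thphi => //.
  by rewrite Mz => a sa; exists phi.
by apply: (ap_model_omits gM); rewrite ?Mz.
Qed.

Section Final.
Variable A : structure LL.
Hypothesis A_models : models A th.
Hypothesis A_omits : omits A 0 wt.

Let Y := rel1 (N := A) RY.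
Let D a := rel1 (N := A) RD (const_val A a).
Let b a := `[< rel1 (N := A) RB (const_val A a) >].

(** Were D contained in a segment of kappa, the range of the map G would be an
    unbounded set of size less than the cofinality of kappa. *)
Lemma D_all l : kappa l -> D l.
Proof.
move=> kl; apply: contrapT => nD.
have [G [Gfun Gcof]] := G_cofinal A_models A_omits.
pose C := [set t | kappa t /\ exists2 a, D a & G a t].
have uC : unbounded kappa C.
  split=> [t []//|u /Gcof[a [t [Da Gat kt ut]]]].
  by exists t => //; split=> //; exists a.
have : cof kappa l by rewrite (kappa_cof kappa_inacc).
move=> /(_ C uC)/card_lt_geF; apply.
have /choice[g gP] : forall a, exists t, D a -> forall t', G a t' -> t = t'.
  move=> a; case: (pselect (exists t, G a t)) => [[t Gt]|nG].
    by exists t => Da t' Gt'; exact: Gfun Gt Gt'.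
  by exists a => _ t' Gt'; case: nG; exists t'.
apply: (@card_le_of_surj _ _ _ _ g) => t [kt [a Da Gat]].
exists a; last exact: gP.
rewrite /seg /= ltNge le_eqVlt; apply/negP => /orP[/eqP la|la];
  apply: nD; first by rewrite la.
exact: (D_down e0 A_models Da la).
Qed.

Let coded (x : set mu) (l : mu) : x #< kappa ->
  exists i, (forall a, dec i (e0, a) <-> x a) /\ dec i (e1, l).
Proof.
move=> sx; have [|i iE] := dec_surj (r := (pair e0 @` x) `|` [set (e1, l)]).
  apply: (small_setU mu_wo kappa_inacc); first exact: small_image.
  by apply: (small_finite kappa_inacc); exact: finite_set1.
exists i; rewrite iE; split; last by right.
move=> a; split; last by left; exists a.
by case=> [[a' xa [<-]]|[/e01]].
Qed.

Lemma caught_branch : cofinal_branch kappa Tr b.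
Proof.
move=> x xs; have [Tdom _ Tsmall] := Tr_tree.
have [TD [eta0 T0]] := Tdom x xs.
have [l kl Tl] := card_lt_seg mu_wo (kappa_cardinal kappa_inacc) (Tsmall x xs).
have [f0 fs0] := card_le_ex_surj eta0 (card_eq_leW Tl).
pose f j := if `[< Tr x (f0 j) >] then f0 j else eta0.
have fT j : Tr x (f j) by rewrite /f; case: asboolP.
have fs eta : Tr x eta -> exists2 j, (j < l)%O & f j = eta.
  by move=> Te; have [j jl fj] := fs0 _ Te; exists j => //; rewrite /f fj asboolT.
have [i [iE _]] := coded l xs.2.
have [|t tE] := dec_surj (r := [set p | [/\ (p.1 < l)%O, x p.2 & f p.1 p.2 = Some true]]).
  apply: (small_sub (B := \bigcup_(j in seg l) pair j @` x)).
    by move=> [j a] [/= jl xa _]; exists j => //; exists a.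
  apply: (small_bigcup mu_wo kappa_inacc) => [|j _]; first exact: (small_seg kappa_inacc).
  exact: small_image xs.2.
have [||j jl bE] := branch_transfer A_models A_omits (i := i) (t := t) xs kl fs _ iE.
- by move=> j /TD.
- by move=> j a; rewrite tE.
suff -> : brestr b x = f j by [].
have df := TD _ (fT j).
apply/funext => a; rewrite /brestr /restr; case: (asboolP (x a)) => xa.
  have := bE a xa; have : dom (f j) a by rewrite df.
  rewrite /dom /= /b; case: (f j a) => // c _ e; congr Some.
  by apply/asboolP/idP => [/e[]|cT] //; apply/e; rewrite cT.
have : ~ dom (f j) a by rewrite df.
by rewrite /dom /= => /negP; rewrite negbK => /eqP.
Qed.

Let ladder_set := [set x | exists2 y, Y y & x = members y].

Lemma caught_club : club kappa [set: mu] ladder_set.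
Proof.
have Dw := D_all kappa_w.
split=> [_ [y Yy ->]|x [_ xs]|l s].
- split=> //; have [l kl yl] := members_small A_models A_omits Yy.
  by apply: card_le_lt_trans yl _; exact: (small_seg kappa_inacc).
- have [l kl xl] := card_lt_seg mu_wo (kappa_cardinal kappa_inacc) xs.
  have [i [iE il]] := coded l xs.
  have [y Yy xy] := Y_cofinal A_models Dw kl xl iE il.
  by exists (members y) => //; exists y.
rewrite (kappa_cof kappa_inacc) => kl l0 sY smono.
have [|t tE] := dec_surj (r := [set p | (p.1 < l)%O /\ s p.1 p.2]).
  apply: (small_sub (B := \bigcup_(j in seg l) pair j @` s j)).
    by move=> [j a] [/= jl sa]; exists j => //; exists a.
  apply: (small_bigcup mu_wo kappa_inacc) => [|j /sY[y Yy ->]].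
    exact: (small_seg kappa_inacc).
  apply: small_image; have [m km ym] := members_small A_models A_omits Yy.
  by apply: card_le_lt_trans ym _; exact: (small_seg kappa_inacc).
by apply: (Y_closed A_models A_omits (t := t) Dw (D_all kl)) => // a u; rewrite tE.
Qed.

Lemma caught_ladder x : ladder_set x -> La (brestr b x).
Proof.
move=> [y Yy ->].
have ys : members y #< kappa.
  have [m km ym] := members_small A_models A_omits Yy.
  by apply: card_le_lt_trans ym _; exact: (small_seg kappa_inacc).
have [|i iE] := dec_surj (r := (pair e0 @` members y) `|`
    (pair e1 @` (members y `&` [set a | b a]))).
  apply: (small_setU mu_wo kappa_inacc); apply: small_image => //.
  by apply: small_sub ys => a [].
apply: (members_La A_models A_omits (i := i)) => //.
have i0 a : dec i (e0, a) <-> members y a.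
  rewrite iE; split; last by left; exists a.
  by case=> [[a' ? [<-]]|[a' _ [/esym/e01]]].
have i1 a : dec i (e1, a) <-> members y a /\ b a.
  rewrite iE; split; last by move=> ?; right; exists a.
  by case=> [[a' _ [/e01]]|[a' [? ?] [<-]]].
apply/funext => a; rewrite /node /brestr /restr.
case: (asboolP (members y a)) => ya; last by rewrite asboolF // => /i0.
rewrite asboolT; last exact/i0; congr Some.
apply/asboolP/idP => [/i1[]//|ba]; exact/i1.
Qed.

End Final.
End LadderSystem.

Lemma tree_language_card : [set: option mu + relname mu] #= [set: mu].
Proof.
have [a0 _] := mu_inh kappa_inacc.
apply: Cantor_Bernstein; last first.
  by apply: (@card_le_of_inj _ _ _ _ (fun a => inl (Some a))) => // a b _ _ [].
have nmu : [set: nat + mu] #<= [set: mu].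
  exact: (card_le_sum mu_wo kappa_inacc mu_pow (card_nat_mu kappa_inacc)).
apply: (card_le_sum mu_wo kappa_inacc mu_pow); apply: card_le_trans nmu.
  apply: (@card_le_of_inj _ _ _ _ 
    (fun o => if o is Some a then inr a else inl 0%N)) => //.
  by move=> [a|] [b|] _ _ // [->].
apply: (@card_le_of_inj _ _ _ _ (fun r : relname mu => match r with
  | RY => inl 0 | RB => inl 1 | RK => inl 2 | RD => inl 3 | RLt => inl 4
  | RG => inl 5 | RE => inl 6 | RS => inl 7 | RC i => inr i end)) => //.
by move=> [||||||||i] [||||||||j] _ _ // [->].
Qed.

Lemma small_relation_codes : exists2 dec : mu -> set (mu * mu),
  (forall i, dec i #< kappa) & forall r, r #< kappa -> exists i, dec i = r.
Proof.
have [g gP] := card_le_ex_surj (set0 : set (mu * mu))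
  (card_small_sets mu_wo kappa_inacc mu_pow
     (card_pairs mu_wo kappa_inacc mu_pow (card_lexx [set: mu]))).
exists (fun i => if `[< g i #< kappa >] then g i else set0) => [i|r sr].
  by case: asboolP => // _; exact: (small_finite kappa_inacc).
by have [i _ gi] := gP r sr; exists i; rewrite gi asboolT.
Qed.

Theorem LSCP_of_compactness :
  compactness_with_type_omission kappa -> LSCP_clubs kappa kappa.
Proof.
move=> compact Tr La Tr_tree La_ladder.
have [dec dec_small dec_surj] := small_relation_codes.
have [w [kw wi wc _]] := omega_ex mu_wo kappa_inacc.
have [e0 e0w] := infinite_setN0 wi.
have [e1 e01] : exists e1, e0 <> e1.
  apply: contrapT => ne; apply: wi; apply: (sub_finite_set (B := [set e0]));
    last exact: finite_set1.
  by move=> a _; apply: contrapT => ea; apply: ne; exists a => e; apply: ea.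
have [||||A [AT Ap]] := compact (tree_language mu) 0
    (intended_theory (kappa := kappa) Tr La dec w) (bad_node_type La dec e0 e1).
- exact: tree_language_card.
- by move=> phi [].
- exact: bad_node_type_formula.
- exact: (approximations Tr_tree La_ladder).
exists (fun a => `[< rel1 (N := A) RB (const_val A a) >]).
  exact: (caught_branch Tr_tree dec_surj e01 AT Ap).
exists [set x | exists2 y, rel1 (N := A) RY y & x = members y].
  exact: (caught_club dec_surj e01 kw AT Ap).
by move=> x; exact: (caught_ladder dec_surj e01 AT Ap).
Qed.

End CompactnessToLadder.

Unset Implicit Arguments.

Theorem theorem19 (d : Order.disp_t) (mu : orderType d) (kappa : set mu)
    (mu_wo : well_order (fun a b : mu => (a <= b)%O))
    (mu_card : is_cardinal [set: mu])
    (kappa_inacc : inaccessible kappa)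
    (mu_pow : [set: short_seqs kappa] #= [set: mu]) :
  (compactness_with_type_omission kappa <-> LSCP_clubs kappa kappa) /\
  (LSCP_clubs kappa kappa <-> LSCP_cofinally kappa kappa).
Proof.
have c2 := LSCP_of_compactness mu_wo mu_card kappa_inacc mu_pow.
have c3 : LSCP_clubs kappa kappa -> LSCP_cofinally kappa kappa.
  move=> lscp Tr La Tr_tree La_ladder.
  have [b Tb [E [EP Ecof _] EL]] := lscp Tr La Tr_tree La_ladder.
  by exists b => // x /Ecof[y Ey xy]; exists y; split; [exact: EP| |exact: EL].
have c1 := compactness_of_LSCP mu_wo mu_card kappa_inacc mu_pow.
by split; split=> h; [exact: c2|exact/c1/c3|exact: c3|exact/c2/c1].
Qed.
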